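(* Let $0<\varepsilon<1$ and $C>0$ be constants. Let $A=(a_{ij})$ be an $n\times n$ real matrix and let $x_1,\dots,x_n,y_1,\dots,y_n$ be independent Bernoulli random variables. Suppose $$\rho_b(A):=\sup_{a\in\mathbb{R}}\mathbb{P}\Big(\sum_{i,j}a_{ij}x_iy_j=a\Big)\ge n^{-C}.$$ Then there exist index sets $I_0,J_0$ of size $O_{C,\varepsilon}(1)$ and index sets $I,J$ of size $n-O_C(n^{\varepsilon})$ with $I\cap I_0=\emptyset$, $J\cap J_0=\emptyset$, integers $k,l$ (nonzero) and integers $k_{ii_0}$ ($i\in I,i_0\in I_0$), $l_{j_0j}$ ($j_0\in J_0,j\in J$), all of absolute value at most $n^{O_{C,\varepsilon}(1)}$, and real numbers $g_1,\dots,g_s$ with $s=O_{C,\varepsilon}(1)$, such that for every $i\in I$: defining for $j\in J$ the numbers $a'_{ij}$ by $$a_{ij}=\frac{a'_{ij}}{kl}-\frac{\sum_{i_0\in I_0}k_{ii_0}a_{i_0j}}{k}-\frac{\sum_{j_0\in J_0}l_{j_0j}a_{ij_0}}{l},$$ all but $O_C(n^{\varepsilon})$ of the numbers $a'_{ij}$, $j\in J$, belong to the set (independent of $i$) $$Q=\Big\{\sum_{h=1}^{s}\frac{p_h}{q_h}g_h : p_h,q_h\in\mathbb{Z},\ q_h\ne0,\ |p_h|,|q_h|\le n^{O_{C,\varepsilon}(1)}\Big\}.$$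
   Context: A Bernoulli random variable takes values $\pm1$ with probability $1/2$ each. $O_{C,\varepsilon}(1)$ denotes a quantity bounded by a constant depending only on $C,\varepsilon$; asymptotics are as $n\to\infty$. *)

(* Defs.v *)
From HB Require Import structures.
From mathcomp Require Export all_boot all_order all_algebra.
From mathcomp Require Export all_classical all_reals all_analysis.
Set Implicit Arguments.
Unset Strict Implicit.
Unset Printing Implicit Defensive.
Import Order.TTheory GRing.Theory Num.Theory.

Local Open Scope classical_set_scope.
Local Open Scope ring_scope.

Definition mutually_independent (R : realType) (d : measure_display)
    (T : measurableType d) (P : probability T R) (I : finType)
    (Z : I -> {RV P >-> R}) : Prop :=
  forall (F : {set I}) (E : I -> set R),
    (forall i, i \in F -> measurable (E i)) ->
    P (\bigcap_(i in [set` F]) (Z i @^-1` E i)) =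
      (\prod_(i in F) P (Z i @^-1` E i))%E.

(* The library's [bernoulli] distribution is the 0/1-valued one. *)
Definition pm1_bernoulli (R : realType) (d : measure_display)
    (T : measurableType d) (P : probability T R) (X : {RV P >-> R}) : Prop :=
  P (X @^-1` [set 1]) = (2^-1)%:E /\ P (X @^-1` [set -1]) = (2^-1)%:E.

(* The x_i and y_j together are 2n mutually independent variables, indexed by
   the disjoint sum of two copies of 'I_n. *)
Definition independent_bernoulli_pair (R : realType) (d : measure_display)
    (T : measurableType d) (P : probability T R) (n : nat)
    (x y : 'I_n -> {RV P >-> R}) : Prop :=
  [/\ forall i, pm1_bernoulli (x i),
      forall j, pm1_bernoulli (y j) &
      mutually_independent
        (fun u : 'I_n + 'I_n => match u with inl i => x i | inr j => y j end)].

Definition rho_b (R : realType) (d : measure_display)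
    (T : measurableType d) (P : probability T R) (n : nat)
    (x y : 'I_n -> {RV P >-> R}) (A : 'M[R]_n) : \bar R :=
  ereal_sup [set P [set w | \sum_i \sum_j A i j * x i w * y j w = a]
            | a in [set: R]].

Definition bounded_rational_combinations (R : realType) (M : R) (s : nat)
    (g : 'I_s -> R) : set R :=
  [set r | exists p q : 'I_s -> int,
    (forall h, [/\ q h != 0, `|(p h)%:~R| <= M & `|(q h)%:~R| <= M]) /\
    r = \sum_h (p h)%:~R / (q h)%:~R * g h].

(* Main.v *)
(* Proof idea.  Let M = 2^e be a small power of n.  Everything is counted over
   signed sums, and Fourier analysis is replaced by the Cauchy-Schwarz inequality
   P(S + S' = a)^2 <= P(S1 + S2 = 0) P(S'1 + S'2 = 0), where S1, S2 (S'1, S'2) are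
   independent copies of S (of S'): iterating it replaces M distinct steps of the
   walk by M copies of one of them.

   Linear case.  Greedily pick steps u with multiplicity M outside the box
   spanned by the previous ones, recording the least q such that q u falls back
   in the box (or M + 1 if there is none up to M).  The box stays proper, each
   pick costs a factor q^(-1/2) of concentration, so the product of the q is at
   most M^(2c).  Hence at most 2c picks are free, the others are torsion with a
   common denominator D <= M^(2c), and all steps but O(M^2) lie in the final box.

   Bilinear case.  For many y the coefficients of x are structured; pigeonholing
   the generators, D, and then for each i the coefficients, gives a row operation
   after which every row is individually concentrated and the whole form still is.
   Doing the same with the columns yields a matrix B with structured rows and
   columns.  If the rows were not structured by common generators one could pick
   pairs (i_1, j_1), (i_2, j_2), ... such that B i_s j_s escapes the span Q_{s-1}
   of the generators of the previous rows and columns, and replace the other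
   variables by copies of these.  All the other entries meeting a previous row or
   column lie in Q_{s-1}, so exposing the pairs from the last to the first each
   pair costs a factor about M^(-1/2), contradicting the concentration. *)

Require Import Defs.
From mathcomp Require Import ring lra zify.
Set Implicit Arguments.
Unset Strict Implicit.
Unset Printing Implicit Defensive.
Import Order.TTheory GRing.Theory Num.Theory.
Local Open Scope ring_scope.

Section Combinatorics.
Import mathcomp.boot.seq mathcomp.boot.finset.

(** * Signed sums *)

(** Kept as a list with multiplicity, one entry per choice of signs, so that averages over it are
    expectations over independent fair signs in any abelian group. *)
Fixpoint ssum (V : zmodType) (s : seq V) : seq V :=
  if s is w :: s' then [seq v + w | v <- ssum s'] ++ [seq v - w | v <- ssum s']
  else [:: 0].

Definition Ex (R : realFieldType) (V : zmodType) (s : seq V) (f : V -> R) : R :=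
  (\sum_(v <- ssum s) f v) / 2 ^+ size s.

Definition pr (R : realFieldType) (V : zmodType) (s : seq V) (a : V) : R :=
  Ex s (fun v => (v == a)%:R).

Section SubtractionMorphisms.
Variables (V W : zmodType) (phi : V -> W).
Hypothesis phiB : {morph phi : x y / x - y}.

Lemma morphB0 : phi 0 = 0.
Proof. by rewrite -(subrr 0) phiB subrr. Qed.

Lemma morphBN x : phi (- x) = - phi x.
Proof. by rewrite -sub0r phiB morphB0 sub0r. Qed.

Lemma morphBD x y : phi (x + y) = phi x + phi y.
Proof. by rewrite -{1}(opprK y) phiB morphBN opprK. Qed.

Lemma morphB_mulrz x (z : int) : phi (x *~ z) = phi x *~ z.
Proof.
have phiMn k : phi (x *+ k) = phi x *+ k.
  elim: k => [|k IH]; first by rewrite !mulr0n morphB0.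
  by rewrite !mulrSr morphBD IH.
by case: z => k; rewrite ?NegzE ?mulrNz ?morphBN -?pmulrn phiMn.
Qed.

End SubtractionMorphisms.

(** Estimates are carried out on squares throughout, because [R] need not contain square roots. *)
Lemma sqr_le_sqr (R : realFieldType) (x y : R) : 0 <= y -> x ^+ 2 <= y ^+ 2 -> x <= y.
Proof. by move=> y0 h; apply: contraLR h; rewrite -!ltNge => h; rewrite ltr_pXn2r// nnegrE// ltW// (le_lt_trans y0). Qed.

Section Expectation.
Variables (R : realFieldType) (V : zmodType).
Implicit Types (s t : seq V) (f g : V -> R).

Lemma Ex_nil f : Ex [::] f = f 0.
Proof. by rewrite /Ex /= big_seq1 expr0 divr1. Qed.

Lemma Ex_cons w s f :
  Ex (w :: s) f = (Ex s (fun v => f (v + w)) + Ex s (fun v => f (v - w))) / 2.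
Proof.
rewrite /Ex /= big_cat /= !big_map exprS.
have h : (2 : R) ^+ size s != 0 by rewrite expf_neq0// pnatr_eq0.
by field.
Qed.

Lemma Ex_mono s f g : (forall v, v \in ssum s -> f v <= g v) -> Ex s f <= Ex s g.
Proof.
move=> h; rewrite /Ex ler_pM2r ?invr_gt0 ?exprn_gt0// big_seq [leRHS]big_seq.
exact: ler_sum.
Qed.

Lemma eq_Ex_in s f g : (forall v, v \in ssum s -> f v = g v) -> Ex s f = Ex s g.
Proof. by move=> h; apply/eqP; rewrite eq_le !Ex_mono// => v /h ->. Qed.

Lemma eq_Ex s f g : f =1 g -> Ex s f = Ex s g.
Proof. by move=> h; apply: eq_Ex_in. Qed.

Lemma Ex_cst s (c : R) : Ex s (fun=> c) = c.
Proof. by elim: s => [|w s IH]; rewrite ?Ex_nil// Ex_cons !IH; field. Qed.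

Lemma Ex_ge0 s f : (forall v, 0 <= f v) -> 0 <= Ex s f.
Proof. by move=> h; rewrite -(Ex_cst s 0); apply: Ex_mono. Qed.

Lemma ExZ s c f : Ex s (fun v => c * f v) = c * Ex s f.
Proof. by rewrite /Ex -mulr_sumr mulrA. Qed.

Lemma Ex_sum (I : Type) (r : seq I) (P : pred I) s (F : I -> V -> R) :
  Ex s (fun v => \sum_(i <- r | P i) F i v) = \sum_(i <- r | P i) Ex s (F i).
Proof. by rewrite /Ex exchange_big /= mulr_suml. Qed.

Lemma ExD s f g : Ex s (fun v => f v + g v) = Ex s f + Ex s g.
Proof. by rewrite /Ex big_split mulrDl. Qed.

Lemma Ex_cat s t f : Ex (s ++ t) f = Ex s (fun u => Ex t (fun v => f (u + v))).
Proof.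
elim: s f => [|w s IH] f /=.
  by rewrite Ex_nil; apply: eq_Ex => v; rewrite add0r.
rewrite !Ex_cons !IH; congr ((_ + _) / _); apply: eq_Ex => u; apply: eq_Ex => v;
  by rewrite addrAC.
Qed.

End Expectation.

Lemma Ex_exch (R : realFieldType) (V W : zmodType) (s : seq V) (t : seq W)
    (F : V -> W -> R) :
  Ex s (fun u => Ex t (F u)) = Ex t (fun v => Ex s (F^~ v)).
Proof. by rewrite /Ex -!mulr_suml exchange_big /= mulrAC. Qed.

Lemma Ex_map (R : realFieldType) (V W : zmodType) (phi : V -> W) (s : seq V)
    (f : W -> R) : {morph phi : x y / x - y} ->
  Ex (map phi s) f = Ex s (fun v => f (phi v)).
Proof.
move=> phiB; elim: s f => [|w s IH] f; first by rewrite !Ex_nil (morphB0 phiB).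
rewrite /= !Ex_cons !IH; congr (_ / _); congr (_ + _); apply: eq_Ex => v; first by rewrite (morphBD phiB).
by rewrite phiB.
Qed.

Section Probability.
Variables (R : realFieldType) (V : zmodType).
Implicit Types (s t : seq V) (f g : V -> R).

Lemma Ex_perm s t f : perm_eq s t -> Ex s f = Ex t f.
Proof.
move: s t; apply: catCA_perm_subst => s1 s2 s3.
rewrite !Ex_cat; under eq_Ex => u do rewrite Ex_cat.
under [RHS]eq_Ex => u do rewrite Ex_cat.
rewrite Ex_exch; apply: eq_Ex => u; apply: eq_Ex => v; apply: eq_Ex => w.
by rewrite addrCA.
Qed.

Lemma Ex_opp s f : Ex s (fun v => f (- v)) = Ex s f.
Proof.
elim: s f => [|w s IH] f; first by rewrite !Ex_nil oppr0.
rewrite !Ex_cons addrC; congr ((_ + _) / _).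
  by rewrite -[RHS]IH; apply: eq_Ex => v; rewrite opprB addrC.
by rewrite -[RHS]IH; apply: eq_Ex => v; rewrite opprD.
Qed.

Lemma Ex_filter_neq0 s f : Ex [seq v <- s | v != 0] f = Ex s f.
Proof.
elim: s f => [|w s IH] f //=; case: eqP => [->|_] /=; last by rewrite !Ex_cons !IH.
rewrite Ex_cons IH.
under [X in _ = (X + _) / _]eq_Ex => v do rewrite addr0.
under [X in _ = (_ + X) / _]eq_Ex => v do rewrite subr0.
by field.
Qed.

(** Cauchy-Schwarz with the square roots of [f] and [g] hidden in a pointwise hypothesis on [h].
    Induction on the steps: the two signs of [w] give two instances, which are then added. *)
Lemma Ex_CS s (h f g : V -> R) :
  (forall v, 0 <= h v) -> (forall v, 0 <= f v) -> (forall v, 0 <= g v) ->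
  (forall v, h v ^+ 2 <= f v * g v) -> Ex s h ^+ 2 <= Ex s f * Ex s g.
Proof.
elim: s h f g => [|w s IH] h f g h0 f0 g0 H; first by rewrite !Ex_nil.
rewrite !Ex_cons.
have H1 := IH _ _ _ (fun v => h0 (v + w)) (fun v => f0 (v + w)) (fun v => g0 (v + w))
  (fun v => H (v + w)).
have H2 := IH _ _ _ (fun v => h0 (v - w)) (fun v => f0 (v - w)) (fun v => g0 (v - w))
  (fun v => H (v - w)).
move: H1 H2 (Ex_ge0 s (fun v => f0 (v + w))) (Ex_ge0 s (fun v => g0 (v + w)))
 (Ex_ge0 s (fun v => f0 (v - w))) (Ex_ge0 s (fun v => g0 (v - w)))
 (Ex_ge0 s (fun v => h0 (v + w))) (Ex_ge0 s (fun v => h0 (v - w))).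
set a := Ex s _; set b := Ex s _; set c := Ex s _; set a' := Ex s _; set b' := Ex s _; set c' := Ex s _.
move=> H1 H2 b0 c0 b'0 c'0 a0 a'0.
(* The cross term of [(a + a') ^+ 2], by the inequality of arithmetic and geometric means. *)
have K : 2 * (a * a') <= b * c' + b' * c.
  apply: sqr_le_sqr; first by rewrite addr_ge0// mulr_ge0.
  have K1 : (a * a') ^+ 2 <= (b * c) * (b' * c').
    by rewrite exprMn ler_pM// sqr_ge0.
  have := sqr_ge0 (b * c' - b' * c); lra.
lra.
Qed.

Lemma pr_ge0 s a : 0 <= pr R s a.
Proof. by apply: Ex_ge0 => v; rewrite ler0n. Qed.

Lemma pr_cat s t a : pr R (s ++ t) a = Ex s (fun u => pr R t (a - u)).
Proof.
rewrite /pr Ex_cat; apply: eq_Ex => u; apply: eq_Ex => v.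
by rewrite [in RHS]eq_sym subr_eq eq_sym addrC.
Qed.

Lemma prN s a : pr R s (- a) = pr R s a.
Proof.
rewrite /pr -[RHS]Ex_opp; apply: eq_Ex => v.
by rewrite eqr_oppLR.
Qed.

Lemma Ex_pr s (D : seq V) f : uniq D -> {subset ssum s <= D} ->
  Ex s f = \sum_(w <- D) pr R s w * f w.
Proof.
move=> uD sD; rewrite /pr; under eq_bigr => w _ do rewrite mulrC -ExZ.
rewrite -Ex_sum; apply: eq_Ex_in => v /sD vD.
rewrite (bigD1_seq v)//= eqxx mulr1 big1 ?addr0// => w.
by rewrite eq_sym => /negbTE ->; rewrite mulr0.
Qed.

Lemma sum_CS (I : Type) (r : seq I) (f g : I -> R) :
  (\sum_(i <- r) f i * g i) ^+ 2 <= (\sum_(i <- r) f i ^+ 2) * (\sum_(i <- r) g i ^+ 2).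
Proof.
elim: r => [|i r IH]; first by rewrite !big_nil expr0n mulr0.
rewrite !big_cons.
have F0 : 0 <= \sum_(i <- r) f i ^+ 2 by apply: sumr_ge0 => ? _; apply: sqr_ge0.
have G0 : 0 <= \sum_(i <- r) g i ^+ 2 by apply: sumr_ge0 => ? _; apply: sqr_ge0.
move: IH F0 G0; set a := \sum_(i <- r) _; set b := \sum_(i <- r) _; set c := \sum_(i <- r) _.
move=> IH b0 c0; move: (f i) (g i) => x y.
have K : 2 * (x * y * a) <= x ^+ 2 * c + b * y ^+ 2.
  apply: sqr_le_sqr; first by rewrite addr_ge0// mulr_ge0// sqr_ge0.
  have K1 : (x * y) ^+ 2 * a ^+ 2 <= (x * y) ^+ 2 * (b * c) by rewrite ler_wpM2l// sqr_ge0.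
  have := sqr_ge0 (x ^+ 2 * c - b * y ^+ 2); lra.
lra.
Qed.

(** Condition on the value of the first sum and apply Cauchy-Schwarz over the values. Each sum of
    squares is a collision probability, which by symmetry is the probability that the doubled walk
    is at 0. *)
Lemma pr_CS s t a :
  pr R (s ++ t) a ^+ 2 <= pr R (s ++ s) 0 * pr R (t ++ t) 0.
Proof.
(* This list contains all values of the first sum, and its reflection [v -> a - v] contains all
   values of the second. *)
pose D := undup (ssum s ++ [seq a - v | v <- ssum t]).
have uD : uniq D by rewrite undup_uniq.
have sD : {subset ssum s <= D} by move=> v vs; rewrite mem_undup mem_cat vs.
have sub (r : seq V) (D' : seq V) : uniq D' -> {subset ssum r <= D'} ->
    pr R (r ++ r) 0 = \sum_(w <- D') pr R r w ^+ 2.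
  move=> uD' rD'; rewrite pr_cat (Ex_pr _ uD' rD'); apply: eq_bigr => w _.
  by rewrite sub0r prN.
rewrite pr_cat (Ex_pr _ uD sD) (sub _ _ uD sD).
rewrite (sub t [seq a - v | v <- D]); last 2 first.
- by rewrite map_inj_uniq// => x y /addrI /oppr_inj.
- move=> v vt; apply/mapP; exists (a - v); last by rewrite opprB addrC subrK.
  by rewrite mem_undup mem_cat; apply/orP; right; apply/mapP; exists v.
rewrite big_map; exact: sum_CS.
Qed.

Lemma pr_perm s t a : perm_eq s t -> pr R s a = pr R t a.
Proof. exact: Ex_perm. Qed.

Lemma pr_catl_le s t a (K : R) : (forall b, pr R t b <= K) -> pr R (s ++ t) a <= K.
Proof. by move=> h; rewrite pr_cat -[leRHS](Ex_cst s); apply: Ex_mono. Qed.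

Lemma pr_dbl_max s a : pr R (s ++ s) a <= pr R (s ++ s) 0.
Proof. apply: sqr_le_sqr; first exact: pr_ge0. exact: pr_CS. Qed.

Lemma pr_sqr s a : pr R s a ^+ 2 <= pr R (s ++ s) 0.
Proof.
have := pr_CS s [::] a; rewrite cats0 /= => /le_trans; apply.
by rewrite /pr Ex_nil eqxx mulr1.
Qed.

(** Conditioning on the steps of [t] only shifts the target, and a doubled walk is most concentrated
    at 0. *)
Lemma pr_drop s t a : pr R ((s ++ t) ++ (s ++ t)) a <= pr R (s ++ s) 0.
Proof.
have -> : pr R ((s ++ t) ++ (s ++ t)) a = pr R ((t ++ t) ++ (s ++ s)) a.
  by apply: pr_perm; apply/permP => p; rewrite !count_cat; lia.
by apply: pr_catl_le => b; apply: pr_dbl_max.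
Qed.

Lemma pr_le1 s a : pr R s a <= 1.
Proof. by rewrite -[leRHS](Ex_cst s); apply: Ex_mono => v _; rewrite lern1; case: eqP. Qed.

End Probability.

(** * Replacing distinct steps by copies of a single one *)

Section Hoelder.
Variables (R : realFieldType) (J : eqType) (V W : zmodType).
Variables (ws : seq W) (c : W -> J -> V).
Implicit Types (s t h U : seq J).

(** The steps depend on an auxiliary random sum [w]. The linear case takes [ws] empty; the bilinear
    case lets [w] run over the values of the other set of variables. *)
Definition apr s : R := Ex ws (fun w => pr R (map (c w) s) 0).

Lemma apr_ge0 s : 0 <= apr s.
Proof. by apply: Ex_ge0 => w; exact: pr_ge0. Qed.

Lemma apr_perm s t : perm_eq s t -> apr s = apr t.
Proof. by move=> st; apply: eq_Ex => w; apply: pr_perm; apply: perm_map. Qed.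

Lemma apr_CS s t : apr (s ++ t) ^+ 2 <= apr (s ++ s) * apr (t ++ t).
Proof.
apply: Ex_CS => w; rewrite ?pr_ge0// !map_cat; exact: pr_CS.
Qed.

Lemma apr_drop s t : apr ((s ++ t) ++ (s ++ t)) <= apr (s ++ s).
Proof. by apply: Ex_mono => w _; rewrite !map_cat; apply: pr_drop. Qed.

Lemma apr_CS_max s t : apr (s ++ t) <= Num.max (apr (s ++ s)) (apr (t ++ t)).
Proof.
apply: sqr_le_sqr; first by rewrite le_max apr_ge0.
apply: le_trans (apr_CS s t) _; rewrite expr2 ler_pM ?apr_ge0// le_max lexx ?orbT//.
Qed.

Let rep r U := flatten (nseq r U).

Lemma rep_cat r U1 U2 : perm_eq (rep r (U1 ++ U2)) (rep r U1 ++ rep r U2).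
Proof.
elim: r => //= r /permP IH; apply/permP => p; have := IH p.
by rewrite /rep /= !count_cat; lia.
Qed.

Lemma rep_double r U : rep (r + r) U = rep r U ++ rep r U.
Proof. by rewrite /rep nseqD flatten_cat. Qed.

(* Halving [U] and applying Cauchy-Schwarz doubles the multiplicity of the better
   half; after [e] rounds a single index is left. *)
Lemma apr_hoelder_rep e r h U : size U = (2 ^ e)%N ->
  exists2 u, u \in U &
    apr ((rep r U ++ h) ++ (rep r U ++ h)) <=
    apr ((nseq (r * 2 ^ e) u ++ h) ++ (nseq (r * 2 ^ e) u ++ h)).
Proof.
elim: e r U => [|e IH] r U.
  case: U => // u [|//] _; exists u; rewrite ?inE//.
  have -> : rep r [:: u] = nseq (r * 2 ^ 0) u.
    by rewrite muln1 /rep; elim: r => //= r ->.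
  by [].
move=> sU.
set U1 := take (2 ^ e) U; set U2 := drop (2 ^ e) U.
have s1 : size U1 = (2 ^ e)%N by rewrite size_take sU ltn_exp2l// ltnSn.
have s2 : size U2 = (2 ^ e)%N by rewrite size_drop sU expnS mul2n -addnn addnK.
have eU : U = U1 ++ U2 by rewrite cat_take_drop.
have p : perm_eq ((rep r U ++ h) ++ (rep r U ++ h))
  ((rep (r + r) U1 ++ h) ++ (rep (r + r) U2 ++ h)).
  have /permP q := rep_cat r U1 U2.
  by apply/permP => p; rewrite eU !rep_double; have := q p; rewrite !count_cat; lia.
have pw : (r * 2 ^ e.+1 = (r + r) * 2 ^ e)%N by rewrite expnS addnn -mul2n mulnCA mulnA.
rewrite (apr_perm p) pw.
have := apr_CS_max (rep (r + r) U1 ++ h) (rep (r + r) U2 ++ h).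
rewrite le_max => /orP[le1|le2].
  have [u uU1 lu] := IH (r + r)%N U1 s1; exists u; first by rewrite eU mem_cat uU1.
  exact: le_trans le1 lu.
have [u uU2 lu] := IH (r + r)%N U2 s2; exists u; first by rewrite eU mem_cat uU2 orbT.
exact: le_trans le2 lu.
Qed.

Lemma apr_hoelder e h U : size U = (2 ^ e)%N ->
  exists2 u, u \in U & apr ((U ++ h) ++ (U ++ h)) <=
    apr ((nseq (2 ^ e) u ++ h) ++ (nseq (2 ^ e) u ++ h)).
Proof.
move=> sU; have [u uU hu] := apr_hoelder_rep 1 h sU; exists u => //.
by move: hu; rewrite /rep /= cats0 mul1n.
Qed.

(** The greedy step of both inverse theorems: a block of [2 ^ e] indices with property [P] leaves
    [r] and is replaced by as many copies of one of its members, without loss of concentration. *)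
Lemma apr_select e (P : pred J) (r h : seq J) : uniq r -> (2 ^ e <= count P r)%N ->
  exists u r', [/\ P u, uniq r', size r = (2 ^ e + size r')%N &
    apr ((r ++ h) ++ (r ++ h)) <=
    apr ((r' ++ (nseq (2 ^ e) u ++ h)) ++ (r' ++ (nseq (2 ^ e) u ++ h)))].
Proof.
move=> ur big; pose U := take (2 ^ e) (filter P r).
have sU : size U = (2 ^ e)%N by rewrite size_takel// size_filter.
have uU : uniq U by rewrite take_uniq// filter_uniq.
have Usub i : i \in U -> P i /\ i \in r by move=> /mem_take; rewrite mem_filter => /andP.
pose r' := [seq i <- r | i \notin U].
have pU : perm_eq r (U ++ r').
  apply: uniq_perm => //.
    rewrite cat_uniq uU filter_uniq// andbT.
    by apply/hasPn => i; rewrite mem_filter => /andP[].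
  by move=> i; rewrite mem_cat mem_filter; have [/Usub[_ ->]|_] := boolP (i \in U).
have [u uUu hu] := apr_hoelder (r' ++ h) sU.
exists u, r'; split.
- by have [] := Usub u uUu.
- exact: filter_uniq.
- by rewrite (perm_size pU) size_cat sU.
- move/permP in pU; apply: le_trans (le_trans hu _); rewrite le_eqVlt; apply/orP; left; apply/eqP.
    by apply: apr_perm; apply/permP => p; have := pU p; rewrite !count_cat; lia.
  by apply: apr_perm; apply/permP => p; rewrite !count_cat; lia.
Qed.

End Hoelder.

(** * Anticoncentration and integer combinations *)

Lemma bin_le_half m k : ('C(m, k) <= 'C(m, m./2))%N.
Proof.
have step i : (i.+1 <= m./2)%N -> ('C(m, i) <= 'C(m, i.+1))%N.
  move=> h; have := mul_bin_left m i => e.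
  rewrite -(leq_pmul2l (ltn0Sn i)) e leq_mul2r; apply/orP; right.
  by have := odd_double_half m; lia.
have mono i j : (i <= j)%N -> (j <= m./2)%N -> ('C(m, i) <= 'C(m, j))%N.
  elim: j => [|j IH]; first by rewrite leqn0 => /eqP ->.
  rewrite leq_eqVlt => /orP[/eqP -> //|ij] jm.
  exact: leq_trans (IH ij (ltnW jm)) (step _ jm).
have [km|mk] := leqP k m./2; first exact: mono.
have [km|/bin_small -> //] := leqP k m.
rewrite -bin_sub//; apply: mono => //.
by have := odd_double_half m; lia.
Qed.

Lemma bin_middle t : 'C((t.*2).+1, t) = 'C((t.*2).+1, t.+1).
Proof. by rewrite -[LHS]bin_sub; [congr ('C(_, _)); lia|lia]. Qed.

Lemma bin_central_double t : ('C((t.*2).+2, t.+1) = 2 * 'C((t.*2).+1, t))%N.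
Proof. by rewrite binS -bin_middle addnn mul2n. Qed.

Lemma central_bin t : ((t.*2).+1 * 'C(t.*2, t) ^ 2 <= 4 ^ t.*2)%N.
Proof.
elim: t => // t IH.
(* The ratio of consecutive central binomial coefficients. *)
have e : (t.+1 * 'C(t.+1.*2, t.+1) = 2 * (t.*2).+1 * 'C(t.*2, t))%N.
  have := mul_bin_diag (t.*2).+1 t; rewrite /= -bin_middle doubleS bin_central_double.
  by rewrite mulnCA => <-; rewrite mulnA.
rewrite -(@leq_pmul2l (t.+1 ^ 2)) ?expn_gt0//.
have -> : (t.+1 ^ 2 * ((t.+1.*2).+1 * 'C(t.+1.*2, t.+1) ^ 2) =
  (t.+1.*2).+1 * (t.+1 * 'C(t.+1.*2, t.+1)) ^ 2)%N by ring.
rewrite e doubleS !expnS.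
set y := (4 ^ t.*2)%N in IH *; set x := 'C(_, _) in IH *; nia.
Qed.

(** The largest atom of a sum of [m] signs is at most (m + 1)^(-1/2), in squared form. The odd case
    comes from the next even one, whose central coefficient is twice the middle one. *)
Lemma bin_sqr_le m k : (m.+1 * 'C(m, k) ^ 2 <= 4 ^ m)%N.
Proof.
apply: (@leq_trans (m.+1 * 'C(m, m./2) ^ 2)%N).
  by rewrite leq_mul2l leq_exp2r// bin_le_half.
have := odd_double_half m; case: (odd m) => /= <-; last first.
  by rewrite add0n doubleK central_bin.
set t := m./2; rewrite add1n /= uphalf_double.
have := central_bin t.+1; rewrite doubleS bin_central_double !expnS.
set y := (4 ^ t.*2)%N; set x := 'C(_, _); nia.
Qed.

Lemma bin_step_sum (R : realFieldType) m (g : nat -> R) :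
  \sum_(j < m.+2) 'C(m.+1, j)%:R * g j =
  \sum_(j < m.+1) 'C(m, j)%:R * (g j + g j.+1).
Proof.
rewrite big_ord_recl /= bin0 mul1r.
under eq_bigr => j _ do rewrite /= /bump /= add1n binS natrD mulrDl.
rewrite big_split /=.
under [RHS]eq_bigr => j _ do rewrite mulrDr.
rewrite [RHS]big_split /= addrA; congr (_ + _).
rewrite big_ord_recr /= bin_small// mul0r addr0.
by rewrite [RHS]big_ord_recl /= bin0 mul1r.
Qed.

Lemma Ex_nseq (R : realFieldType) (V : zmodType) m (u : V) (f : V -> R) :
  Ex (nseq m u) f = \sum_(j < m.+1) 'C(m, j)%:R * f (u *+ j *+ 2 - u *+ m) / 2 ^+ m.
Proof.
elim: m f => [|m IH] f.
  by rewrite Ex_nil big_ord1 /= bin0 mul0rn subr0 mul1r divr1.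
rewrite [nseq _ _]/= Ex_cons !IH -!mulr_suml.
rewrite (bin_step_sum m (fun j => f (u *+ j *+ 2 - u *+ m.+1))).
rewrite -mulrDl -big_split /= exprS [in RHS]invfM mulrCA mulrC; congr (_ * (_ * _)).
apply: eq_bigr => j _; rewrite -mulrDr addrC; congr (_ * (f _ + f _)).
  by rewrite [u *+ m.+1]mulrSr opprD addrA.
rewrite [u *+ j.+1]mulrSr mulrnDl [u *+ m.+1]mulrSr opprD addrACA.
by rewrite [u *+ 2]mulr2n addrK.
Qed.

(** When [f] is nonzero for at most one number [j] of plus signs, a single binomial term survives,
    and [bin_sqr_le] bounds its weight. *)
Lemma Ex_nseq_single (R : realFieldType) (V : zmodType) m (u : V) (f : V -> R) :
  (forall j j', (j <= m)%N -> (j' < j)%N ->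
    f (u *+ j *+ 2 - u *+ m) != 0 -> f (u *+ j' *+ 2 - u *+ m) != 0 -> False) ->
  exists x, Ex (nseq m u) f ^+ 2 * m.+1%:R <= f x ^+ 2.
Proof.
move=> single; rewrite Ex_nseq.
have p0 : 0 < (2 : R) ^+ m by rewrite exprn_gt0.
have [/existsP[j jn]|/existsPn none] :=
    boolP [exists j : 'I_m.+1, f (u *+ j *+ 2 - u *+ m) != 0]; last first.
  exists 0; rewrite big1 ?expr0n ?mul0r ?sqr_ge0// => j _.
  by have /negPn/eqP -> := none j; rewrite mulr0 mul0r.
exists (u *+ j *+ 2 - u *+ m).
rewrite (bigD1 j)//= big1 => [|i ij]; last first.
  have [->|fi] := eqVneq (f (u *+ i *+ 2 - u *+ m)) 0; first by rewrite mulr0 mul0r.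
  exfalso; have [lt|lt|/val_inj e] := ltngtP i j; last by rewrite e eqxx in ij.
    by apply: (single j i) => //; rewrite -ltnS.
  by apply: (single i j) => //; rewrite -ltnS.
rewrite addr0; set x := f _.
have b := bin_sqr_le m j.
have {}b : m.+1%:R * 'C(m, j)%:R ^+ 2 <= (2 ^+ m) ^+ 2 :> R.
  by rewrite -!natrX -natrM ler_nat -[((2 ^ m) ^ 2)%N]expnAC.
have -> : ('C(m, j)%:R * x / 2 ^+ m) ^+ 2 * m.+1%:R =
    (m.+1%:R * 'C(m, j)%:R ^+ 2) / (2 ^+ m) ^+ 2 * x ^+ 2.
  by rewrite !exprMn exprVn; ring.
by rewrite ler_piMl ?sqr_ge0// ler_pdivrMr ?mul1r// exprn_gt0.
Qed.

(** * Integer combinations of bounded height *)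

Section Combinations.
Variable (V : zmodType).
Implicit Types (G : seq V) (v : V).

(** Generators are peeled off one at a time, in parallel with [box] below; [combP] gives the closed
    form. *)
Fixpoint comb (h : nat) G v : Prop :=
  if G is g :: G' then exists z : int, (`|z| <= h)%N /\ comb h G' (v - g *~ z)
  else v = 0.

Lemma comb_le h h' G v : (h <= h')%N -> comb h G v -> comb h' G v.
Proof.
move=> hh; elim: G v => //= g G IH v [z [zh /IH vz]]; exists z; split=> //.
exact: leq_trans zh hh.
Qed.

Lemma comb0 h G : comb h G 0.
Proof. by elim: G => //= g G IH; exists 0; rewrite mulr0z subr0. Qed.

Lemma combD h h' G v v' : comb h G v -> comb h' G v' -> comb (h + h') G (v + v').
Proof.
elim: G v v' => [|g G IH] v v' /=; first by move=> -> ->; rewrite addr0.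
move=> [z [zh hz]] [z' [zh' hz']]; exists (z + z'); split; first by lia.
by rewrite mulrzDr opprD addrACA; apply: IH.
Qed.

Lemma combZ h G v (a : int) : comb h G v -> comb (`|a| * h) G (v *~ a).
Proof.
elim: G v => [|g G IH] v /=; first by move=> ->; rewrite mul0rz.
move=> [z [zh hz]]; exists (z * a); split; first by rewrite abszM mulnC leq_mul.
by rewrite mulrzA -mulrzBl; apply: IH.
Qed.

Lemma combMn h G v (a : nat) : comb h G v -> comb (a * h) G (v *+ a).
Proof. by move=> /(combZ a%:Z); rewrite absz_nat. Qed.

Lemma comb_catl h G G' v : comb h G v -> comb h (G ++ G') v.
Proof.
elim: G v => [|g G IH] v /=; first by move=> ->; apply: comb0.
by move=> [z [zh /IH hz]]; exists z.
Qed.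

Lemma comb_catr h G G' v : comb h G' v -> comb h (G ++ G') v.
Proof.
elim: G v => [|g G IH] v //= /IH hv; exists 0; rewrite mulr0z subr0; split=> //.
Qed.

Lemma combP h G v : comb h G v <->
  exists p : nat -> int, (forall i, (`|p i| <= h)%N) /\
    v = \sum_(i < size G) G`_i *~ p i.
Proof.
split.
  elim: G v => [|g G IH] v /=.
    by move=> ->; exists (fun=> 0); split; rewrite ?big_ord0.
  move=> [z [zh /IH [p [ph e]]]].
  exists (fun i => if i is j.+1 then p j else z); split; first by case.
  by rewrite big_ord_recl /= -e addrC subrK.
elim: G v => [|g G IH] v /= [p [ph ->]]; first by rewrite big_ord0.
exists (p 0%N); split=> //; apply: IH; exists (fun i => p i.+1); split=> //.
by rewrite big_ord_recl /= addrC addKr.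
Qed.

End Combinations.

(** * The inverse theorem for linear forms *)

Section InverseLinear.
Variables (R : realFieldType) (J : eqType) (a : J -> R) (M : nat).
Hypothesis M0 : (0 < M)%N.
Notation state := (seq (J * nat * bool)).
Implicit Types (st : state) (v : R).

(* In an entry [(u, q, b)] of a state, [q] is the least positive integer such that
   [q] times step [u] lies in the box of the older entries; when no [q <= M] works,
   [q = M + 1] and [b = true] marks [u] as a free generator. *)
Fixpoint box st v : Prop :=
  if st is x :: st' then
    exists z : int, (`|z| < x.1.2)%N /\ box st' (v - a x.1.1 *~ z)
  else v = 0.

Fixpoint wf st : Prop :=
  if st is x :: st' then
    [/\ wf st', (1 < x.1.2)%N, (x.1.2 <= M.+1)%N,
        forall z, (0 < z < x.1.2)%N -> ~ box st' (a x.1.1 *+ z) &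
        if x.2 then x.1.2 = M.+1 else box st' (a x.1.1 *+ x.1.2)]
  else True.

(** [vol] counts the coefficient choices of the box and is controlled by concentration; [den], its
    torsion part, is the denominator that expresses box elements through the free generators. *)
Definition vol st := (\prod_(x <- st) x.1.2)%N.
Definition den st := (\prod_(x <- st | ~~ x.2) x.1.2)%N.
Definition gens st : seq J := [seq x.1.1 | x <- st & x.2].
(** With q - 1 copies of a step the number of plus signs takes q values, as many as the box allows.
    The selection supplies [M >= q - 1] copies, listed in [copies]. *)
Definition steps st : seq R := flatten [seq nseq x.1.2.-1 (a x.1.1) | x <- st].
Definition copies st : seq J := flatten [seq nseq M x.1.1 | x <- st].

Lemma ssum_nseq_cat m (u : R) t v : v \in ssum (nseq m u ++ t) ->
  exists j w, [/\ (j <= m)%N, w \in ssum t & v = w + (u *+ j *+ 2 - u *+ m)].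
Proof.
elim: m v => [|m IH] v /=.
  by move=> vt; exists 0%N, v; split; rewrite // mulr0n subr0 mul0rn addr0.
rewrite mem_cat => /orP[] /mapP[x /IH[j [w [jm wt ->]]] ->].
  exists j.+1, w; split=> //; rewrite [u *+ j.+1]mulrSr mulrnDl [u *+ m.+1]mulrSr.
  ring.
by exists j, w; split; rewrite ?(leqW jm)// [u *+ m.+1]mulrSr; ring.
Qed.

Lemma steps_diff st v w : wf st -> v \in ssum (steps st) -> w \in ssum (steps st) ->
  exists2 x, box st x & v - w = x *+ 2.
Proof.
elim: st v w => [|[[u q] b] st IH] v w.
  rewrite /steps /= !inE => _ /eqP -> /eqP ->; exists 0 => //.
  by rewrite subr0 mul0rn.
have -> : steps ((u, q, b) :: st) = nseq q.-1 (a u) ++ steps st by [].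
rewrite [wf _]/= => -[wst /= q1 _ _ _].
move=> /ssum_nseq_cat[j [v' [jm v't ->]]] /ssum_nseq_cat[j' [w' [j'm w't ->]]].
have [x bx e] := IH _ _ wst v't w't.
exists (x + a u *~ (j%:Z - j'%:Z)).
  by exists (j%:Z - j'%:Z); rewrite addrK; split=> //; lia.
rewrite mulrnDl -e mulrzBr -!pmulrn; ring.
Qed.

Lemma pr_neq0 (s : seq R) v : pr R s v != 0 -> v \in ssum s.
Proof.
apply: contraR => vs; rewrite /pr -(Ex_cst s 0); apply/eqP; apply: eq_Ex_in => w ws.
by case: eqP vs => // <-; rewrite ws.
Qed.

(** Each entry costs a factor q^(-1/2): expose its copies first, and properness leaves at most one
    number of plus signs for which the older steps can still reach the target. *)
Lemma pr_steps st v : wf st -> pr R (steps st) v ^+ 2 * (vol st)%:R <= 1.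
Proof.
elim: st v => [|[[u q] b] st IH] v.
  by rewrite /vol big_nil mulr1 => _; rewrite expr_le1// ?pr_ge0 ?pr_le1.
rewrite [wf _]/= => -[wst /= q1 qM proper _].
rewrite /vol big_cons /= -/(vol st) natrM mulrA.
have -> : steps ((u, q, b) :: st) = nseq q.-1 (a u) ++ steps st by [].
have V0 : 0 < (vol st)%:R :> R.
  rewrite ltr0n; clear -wst; elim: st wst => [|x st IH] /=; first by rewrite /vol big_nil.
  by move=> [/IH h q1 _ _ _]; rewrite /vol big_cons muln_gt0 h (ltn_trans _ q1).
rewrite pr_cat.
(* If two numbers [j' < j] of plus signs both allowed the target, [a u *+ (j - j')] would lie in the
   older box although [0 < j - j' < q]. *)
have [|x] := @Ex_nseq_single R R q.-1 (a u) (fun w => pr R (steps st) (v - w)).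
  move=> j j' jq j'j /pr_neq0 h /pr_neq0 h'; have [x bx] := steps_diff wst h' h.
  move=> e; apply: (proper (j - j')%N); first by rewrite /= in jq q1 *; lia.
  suff <- : x = a u *+ (j - j') by [].
  suff : (x - a u *+ (j - j')) *+ 2 == 0 by rewrite mulrn_eq0 subr_eq0 => /eqP.
  by rewrite mulrnBl -e mulrnBr 1?ltnW// mulrnBl; apply/eqP; ring.
rewrite (ltn_predK q1) => le.
apply: le_trans (IH (v - x) wst).
by rewrite ler_pM2r.
Qed.

(** Every entry has [q >= 2]; hence a bound on the volume limits the number of greedy rounds
    logarithmically. *)
Lemma vol_ge st : wf st -> (2 ^ size st <= vol st)%N.
Proof.
elim: st => [|x st IH] /=; first by rewrite /vol big_nil.
by move=> [/IH h q1 _ _ _]; rewrite /vol big_cons expnS leq_mul.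
Qed.

Lemma den_gt0 st : wf st -> (0 < den st)%N.
Proof.
elim: st => [|x st IH] /=; first by rewrite /den big_nil.
move=> [/IH h q1 _ _ _]; rewrite /den big_cons; case: ifP => // _.
by rewrite muln_gt0 h (ltn_trans _ q1).
Qed.

(** Free entries have [q = M + 1], so a bound on the volume limits both the denominator and the
    number of free generators. *)
Lemma vol_split st : wf st -> vol st = (den st * M.+1 ^ size (gens st))%N.
Proof.
elim: st => [|x st IH] /=; first by rewrite /vol /den !big_nil.
move=> [/IH h _ _ _]; rewrite /vol /den /gens !big_cons /= -/(vol st) -/(den st) h.
by case: x.2 => /= [->|_]; rewrite ?size_map ?expnS /gens ?size_map; lia.
Qed.

(* Each torsion entry doubles the height at most, and there are only logarithmically
   many entries, whence the factor [2 ^ size st]. *)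
Lemma comb_den st v : wf st -> box st v ->
  comb (den st * M * 2 ^ size st) (map a (gens st)) (v *+ den st).
Proof.
elim: st v => [|[[u q] b] st IH] v; first by move=> _ /= ->; rewrite mul0rn.
rewrite [wf _]/= => -[wst /= q1 qM _ hq] [z [zq /(IH _ wst) hv]].
have e : v = (v - a u *~ z) + a u *~ z by rewrite subrK.
case: b hq => hq.
  rewrite /gens /= /den big_cons /= -/(den st).
  exists (z * (den st)%:Z); split.
    rewrite abszM absz_nat; apply: (@leq_trans (M * den st)).
      by rewrite leq_mul2r -ltnS -hq zq orbT.
    by rewrite (mulnC M) leq_pmulr// expn_gt0.
  rewrite mulrzA -pmulrn -mulrnBl; apply: comb_le hv.
  by rewrite leq_mul2l leq_exp2l// leqnSn orbT.
rewrite /gens /= /den big_cons /= -/(den st).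
rewrite {1}e mulrnDl.
have := combD (combMn q hv) (combZ z (IH _ wst hq)).
rewrite -!mulrnA (mulnC _ q).
have -> : a u *+ (q * den st) *~ z = a u *~ z *+ (q * den st).
  by rewrite !pmulrn mulrzAC.
apply: comb_le.
apply: (@leq_trans (q * (den st * M * 2 ^ size st) + q * (den st * M * 2 ^ size st))).
  by rewrite leq_add2l leq_mul2r (ltnW zq) orbT.
by rewrite expnS; set x := (2 ^ _)%N; nia.
Qed.

Lemma copies_steps st : wf st ->
  exists t, perm_eq (map a (copies st)) (t ++ steps st).
Proof.
elim: st => [|[[u q] b] st IH]; first by exists [::].
rewrite [wf _]/= => -[/IH [t /permP pt] /= q1 qM _ _].
exists (nseq (M - q.-1) (a u) ++ t).
have -> : copies ((u, q, b) :: st) = nseq M u ++ copies st by [].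
have -> : steps ((u, q, b) :: st) = nseq q.-1 (a u) ++ steps st by [].
rewrite map_cat map_nseq.
have -> : nseq M (a u) = nseq q.-1 (a u) ++ nseq (M - q.-1) (a u).
  by rewrite -nseqD; congr nseq; lia.
by apply/permP => p; have := pt p; rewrite !count_cat; lia.
Qed.

(** Everything except one set of [steps] is exposed; [pr_steps] holds for every resulting target,
    and Cauchy-Schwarz moves the square inside the average. *)
Lemma pr_copies st (rest : seq J) : wf st ->
  pr R (map a ((rest ++ copies st) ++ (rest ++ copies st))) 0 ^+ 2 * (vol st)%:R <= 1.
Proof.
move=> wst; have [t /permP pt] := copies_steps wst.
have -> : pr R (map a ((rest ++ copies st) ++ (rest ++ copies st))) 0 =
  pr R ((map a rest ++ map a rest ++ map a (copies st) ++ t) ++ steps st) 0.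
  have pe : perm_eq (map a ((rest ++ copies st) ++ (rest ++ copies st)))
      ((map a rest ++ map a rest ++ map a (copies st) ++ t) ++ steps st).
    by apply/permP => p; have := pt p; rewrite !map_cat !count_cat; lia.
  exact: pr_perm pe.
rewrite pr_cat.
set s := _ ++ _.
apply: (@le_trans _ _ (Ex s (fun u => pr R (steps st) (0 - u) ^+ 2 * (vol st)%:R))).
  rewrite [leRHS](_ : _ = Ex s (fun u => pr R (steps st) (0 - u) ^+ 2) * (vol st)%:R).
    rewrite ler_wpM2r ?ler0n//.
    rewrite -[leRHS]mulr1 -[X in _ * X](Ex_cst s); apply: Ex_CS => v; rewrite ?mulr1//.
    - exact: pr_ge0.
    - exact: sqr_ge0.
  by rewrite mulrC -ExZ; apply: eq_Ex => v; rewrite mulrC.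
by rewrite -[leRHS](Ex_cst s); apply: Ex_mono => v _; apply: pr_steps.
Qed.

(** Minimality of the recorded [q] is exactly the properness of the enlarged box; [q = 1] is
    excluded because [a u] lies outside the old box. *)
Lemma extend st u : wf st -> ~ box st (a u) -> exists q b, wf ((u, q, b) :: st).
Proof.
move=> wst nb.
have [[q q0 hq]|none] := pselect (exists2 q, (0 < q <= M)%N & box st (a u *+ q)).
  have ex : exists q, (0 < q)%N && `[< box st (a u *+ q) >].
    by exists q; case/andP: q0 => -> _; apply/asboolP.
  case: (ex_minnP ex) => p /andP[p0 /asboolP bp] pmin.
  exists p, false; split=> //=.
  - by case: p p0 bp {pmin} => [//|[|//]] _; rewrite mulr1n.
  - have : (p <= q)%N by apply: pmin; case/andP: q0 => -> _; apply/asboolP.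
    by case/andP: q0; lia.
  - move=> z /andP[z0 zp] bz; have : (p <= z)%N by apply: pmin; rewrite z0; apply/asboolP.
    by rewrite leqNgt zp.
exists M.+1, true; split=> //= z /andP[z0 zM] bz; apply: none; exists z => //.
by rewrite z0.
Qed.

End InverseLinear.

(** Select greedily until fewer than [M] remaining steps lie outside the box; the free entries are
    the generators and the torsion entries give [D]. *)
Lemma inverse_littlewood_offord (R : realFieldType) (n : nat) (a : 'I_n -> R) (e c : nat) :
  (0 < e)%N -> ((2 ^ e)%:R ^- c <= pr R (map a (enum 'I_n ++ enum 'I_n)) 0) ->
  exists (g : seq 'I_n) (D : nat) (E : {set 'I_n}),
    [/\ (size g <= 2 * c)%N, (0 < D <= (2 ^ e) ^ (2 * c))%N,
        (#|E| <= (2 * c).+1 * (2 ^ e) ^ 2)%N &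
        forall i, i \notin E -> comb ((2 ^ e) ^ (4 * c).+1) (map a g) (a i *+ D)].
Proof.
set M := (2 ^ e)%N => e0 ha.
have M0 : (0 < M)%N by rewrite expn_gt0.
have M2 : (1 < M)%N by rewrite -{1}(expn0 2) ltn_exp2l.
(* Each round keeps the lower bound on concentration and uses up [M] indices. *)
pose inv st (rest : seq 'I_n) := [/\ wf a M st, uniq rest,
  M%:R ^- c <= pr R (map a ((rest ++ copies M st) ++ (rest ++ copies M st))) 0 &
  (n <= size rest + size st * M)%N].
(* The lower bound M^(-c), squared, against the upper bound of [pr_copies]. *)
have volM st rest : inv st rest -> (vol st <= M ^ (2 * c))%N.
  move=> [wst _ h _]; have := pr_copies M0 rest wst.
  have p0 : 0 < (M%:R : R) ^+ c by rewrite exprn_gt0// ltr0n.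
  have : (M%:R ^- c) ^+ 2 <= pr R (map a ((rest ++ copies M st) ++ (rest ++ copies M st))) 0 ^+ 2.
    by rewrite ler_pXn2r// nnegrE ?pr_ge0// invr_ge0 ltW.
  move=> h1 h2; have : (M%:R ^- c) ^+ 2 * (vol st)%:R <= 1 :> R.
    by apply: le_trans h2; rewrite ler_wpM2r.
  have q0 : 0 < ((M%:R : R) ^+ c) ^+ 2 by rewrite exprn_gt0.
  rewrite exprVn [X in X <= _]mulrC (ler_pdivrMr _ _ q0) mul1r -exprM -natrX ler_nat.
  by rewrite mulnC.
have sizeM st rest : inv st rest -> (size st <= 2 * c * e)%N.
  move=> i; have := volM _ _ i; case: i => wst _ _ _ h.
  rewrite -(@leq_exp2l 2)//; apply: leq_trans (vol_ge wst) _; apply: leq_trans h _.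
  by rewrite /M -expnM mulnC.
have [st [rest [I small]]] : exists st rest, inv st rest /\
    (count (fun i => ~~ `[< box a st (a i) >]) rest < M)%N.
  (* [N] bounds the remaining rounds; [sizeM] shows that it cannot run out before the selection
     stops. *)
  suff H : forall N st rest, inv st rest -> (2 * c * e < size st + N)%N ->
      exists st rest, inv st rest /\ (count (fun i => ~~ `[< box a st (a i) >]) rest < M)%N.
    apply: (H (2 * c * e).+1 [::] (enum 'I_n)) => //; split=> //=.
    - exact: enum_uniq.
    - by rewrite cats0.
    - by rewrite size_enum_ord mul0n addn0.
  elim=> [|N IH] st rest I; first by rewrite addn0 ltnNge (sizeM _ _ I).
  move=> hN; pose B i := ~~ `[< box a st (a i) >].
  have [small|big] := ltnP (count B rest) M; first by exists st, rest.
  case: (I) => wst urest hpr hn.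
  have [u [rest' [Bu urest' szr]]] := @apr_select R _ R R [::] (fun=> a) e B _
    (copies M st) urest big.
  rewrite /apr !Ex_nil -/M => hu.
  have [q [b wst']] := extend M0 wst (elimN (asboolP _) Bu).
  apply: (IH ((u, q, b) :: st) rest'); last by rewrite /= addSn -addnS.
  split=> //; first exact: le_trans hpr hu.
  by rewrite [size (_ :: _)]/= mulSn addnCA addnA -szr.
case: (I) => wst urest hpr hn.
have hv := volM _ _ I; have hs := sizeM _ _ I.
have dv := vol_split M0 wst.
have d0 := den_gt0 wst.
have lv : (den st <= vol st)%N by rewrite dv leq_pmulr// expn_gt0.
(* The exceptional indices are the fewer than [M] left outside the box and those consumed, at most
   [2 * c * e * M] with [e < M]. *)
exists (gens st), (den st), [set i | ~~ `[< box a st (a i) >] || (i \notin rest)]; split.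
- rewrite -(@leq_exp2l M)//; apply: leq_trans hv; rewrite dv.
  apply: (@leq_trans (M.+1 ^ size (gens st))); first by case: (size _) => // k; rewrite leq_exp2r.
  by rewrite leq_pmull.
- by rewrite d0 (leq_trans lv hv).
- have E1 : (#|[set i | ~~ `[< box a st (a i) >] || (i \notin rest)]| <=
      count (fun i => ~~ `[< box a st (a i) >]) rest + #|[set i | i \notin rest]|)%N.
    rewrite (_ : [set i | _] = [set i in [seq i <- rest | ~~ `[< box a st (a i) >]]] :|: [set i | i \notin rest]).
      rewrite (leq_trans (leq_card_setU _ _))// leq_add2r -size_filter.
      by rewrite cardsE card_size.
    apply/setP => i; rewrite !inE mem_filter; case: (i \in rest); rewrite ?orbT ?orbF ?andbT//.
  have E2 : (#|[set i | i \notin rest]| + size rest = n)%N.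
    have -> : [set i | i \notin rest] = ~: [set i in rest] by apply/setP => i; rewrite !inE.
    by have := cardsC [set i in rest]; rewrite cardsE (card_uniqP urest) card_ord addnC.
  have eM : (e < M)%N by rewrite ltn_expl.
  apply: (leq_trans E1); set k := count _ _ in small *; set k' := #|_| in E2 *.
  have : (k' <= 2 * c * e * M)%N.
    by apply: (@leq_trans (size st * M)); [lia|rewrite leq_mul2r hs orbT].
  have : (2 * c * e * M <= 2 * c * M * M)%N by rewrite leq_mul2r leq_mul2l (ltnW eM) !orbT.
  by rewrite expnS expn1; nia.
- move=> i; rewrite inE negb_or !negbK => /andP[/asboolP bi _].
  apply: comb_le (comb_den M0 wst bi).
  have : (2 ^ size st <= M ^ (2 * c))%N := leq_trans (vol_ge wst) hv.
  (* The three summands are the exponents of [den st], [M] and [2 ^ size st]. *)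
  have -> : ((4 * c).+1 = 2 * c + 1 + 2 * c)%N by lia.
  rewrite (expnD _ (2 * c + 1)) (expnD _ (2 * c) 1).
  by move=> h; apply: leq_mul h; apply: leq_mul; [exact: leq_trans lv hv|rewrite expn1].
Qed.

(** * Bilinear forms and row operations *)

Section LinearForms.
Variables (R : realFieldType) (n : nat).
Implicit Types (c : 'I_n -> R) (X Y : {ffun 'I_n -> int}) (xs ys : seq 'I_n).

Definition unit_vec (i : 'I_n) : {ffun 'I_n -> int} := [ffun j => (j == i)%:Z].

Definition lin c X : R := \sum_i c i *~ X i.

Lemma linB c : {morph lin c : X Y / X - Y}.
Proof.
move=> X Y; rewrite /lin -sumrB; apply: eq_bigr => i _.
by rewrite !ffunE mulrzBr.
Qed.

Lemma lin_unit c i : lin c (unit_vec i) = c i.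
Proof.
rewrite /lin (bigD1 i)//= ffunE eqxx mulr1z big1 ?addr0// => j /negbTE ji.
by rewrite ffunE ji mulr0z.
Qed.

Lemma Ex_lin c xs (f : R -> R) :
  Ex (map unit_vec xs) (fun X => f (lin c X)) = Ex (map c xs) f.
Proof.
rewrite -(Ex_map _ _ (@linB c)).
by rewrite -map_comp; congr Ex; apply: eq_map => i /=; apply: lin_unit.
Qed.

Lemma pr_lin c xs a :
  pr R (map c xs) a = Ex (map unit_vec xs) (fun X => (lin c X == a)%:R).
Proof. by rewrite /pr -Ex_lin. Qed.

Lemma ssum_bound (V : zmodType) (psi : V -> int) (s : seq V) h v :
  {morph psi : x y / x - y} -> (forall w, w \in s -> (`|psi w| <= h)%N) ->
  v \in ssum s -> (`|psi v| <= size s * h)%N.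
Proof.
move=> psiB; elim: s v => [|w s IH] v sh /=; first by rewrite inE => /eqP ->; rewrite (morphB0 psiB).
have wh := sh w (mem_head _ _).
have {}IH x : x \in ssum s -> (`|psi x| <= size s * h)%N.
  by apply: IH => y ys; apply: sh; rewrite inE ys orbT.
set B := (size s * h)%N in IH; rewrite mulSn -/B.
rewrite mem_cat => /orP[] /mapP[x /IH xh ->]; first by rewrite (morphBD psiB); lia.
by rewrite psiB; lia.
Qed.

(** The variables form an integer vector, a signed sum of unit vectors, so an index repeated in [xs]
    or [ys] gets the sum of the signs of its copies. *)
Definition bpr (A : 'I_n -> 'I_n -> R) xs ys : R :=
  Ex (map unit_vec xs) (fun X => pr R (map (fun j => lin (A^~ j) X) ys) 0).

Lemma lin_exch (A : 'I_n -> 'I_n -> R) X Y :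
  lin (fun j => lin (A^~ j) X) Y = lin (fun i => lin (A i) Y) X.
Proof.
rewrite /lin; under eq_bigr => j _ do rewrite mulrz_suml.
rewrite exchange_big; apply: eq_bigr => i _ /=; rewrite mulrz_suml.
by apply: eq_bigr => j _; rewrite mulrzAC.
Qed.

Lemma bprE (A : 'I_n -> 'I_n -> R) xs ys : bpr A xs ys =
  Ex (map unit_vec ys) (fun Y => pr R (map (fun i => lin (A i) Y) xs) 0).
Proof.
rewrite /bpr; under eq_Ex => X do rewrite pr_lin.
rewrite Ex_exch; apply: eq_Ex => Y; rewrite pr_lin; apply: eq_Ex => X.
by rewrite lin_exch.
Qed.

Lemma bpr_tr (A : 'I_n -> 'I_n -> R) xs ys : bpr (fun i j => A j i) xs ys = bpr A ys xs.
Proof. by rewrite [RHS]bprE. Qed.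

End LinearForms.

(** * Pigeonholing expectations over finitely many labels *)

Section Pigeonhole.
Variables (R : realFieldType) (V : zmodType).

Definition ind (P : Prop) : R := `[< P >]%:R.

Lemma ind_ge0 P : 0 <= ind P.
Proof. exact: ler0n. Qed.

Lemma ind_true P : P -> ind P = 1.
Proof. by move=> h; rewrite /ind asboolT. Qed.

Lemma ind_false P : ~ P -> ind P = 0.
Proof. by move=> h; rewrite /ind asboolF. Qed.

Lemma pigeonhole (L : finType) (l0 : L) (s : seq V) (f : V -> R) (F : L -> V -> R) :
  (forall v, v \in ssum s -> f v <= \sum_l F l v) ->
  exists l, Ex s f <= #|L|%:R * Ex s (F l).
Proof.
move=> h; apply/not_existsP => none.
have L0 : (0 < #|L|)%N by apply/card_gt0P; exists l0.
have h1 : Ex s f <= \sum_l Ex s (F l) by rewrite -Ex_sum; apply: Ex_mono.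
have h2 : \sum_l #|L|%:R * Ex s (F l) < \sum_(l : L) Ex s f.
  apply: ltr_sum; first by apply/hasP; exists l0; rewrite ?mem_index_enum.
  by move=> l _; rewrite ltNge; apply/negP; apply: none.
have : #|L|%:R * Ex s f <= \sum_l #|L|%:R * Ex s (F l).
  by rewrite -mulr_sumr ler_wpM2l ?ler0n.
by move=> /le_lt_trans/(_ h2); rewrite sumr_const mulr_natl ltxx.
Qed.

Lemma pigeonhole_ind (L : finType) (l0 : L) (s : seq V) (f : V -> R) (Q : L -> V -> Prop) :
  (forall v, 0 <= f v) ->
  (forall v, v \in ssum s -> f v != 0 -> exists l, Q l v) ->
  exists l, Ex s f <= #|L|%:R * Ex s (fun v => ind (Q l v) * f v).
Proof.
move=> f0 h; apply: pigeonhole => // v vs.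
have [fv|fv] := eqVneq (f v) 0.
  by rewrite fv; apply: sumr_ge0 => l _; rewrite mulr0.
have [l ql] := h v vs fv; rewrite (bigD1 l)//= ind_true// mul1r lerDl.
by apply: sumr_ge0 => k _; rewrite mulr_ge0// ind_ge0.
Qed.

End Pigeonhole.

Lemma int_label (h : nat) (z : int) : (`|z| <= h)%N ->
  exists l : 'I_(2 * h).+1, z = l%:Z - h%:Z.
Proof.
move=> zh; have lt : (`|(z + h%:Z)%R| < (2 * h).+1)%N by lia.
by exists (Ordinal lt) => /=; lia.
Qed.

Lemma pow_label M b : (1 < M)%N -> ((2 * M ^ b).+1 <= M ^ (b + 2))%N.
Proof.
move=> M1; rewrite expnD; have : (0 < M ^ b)%N by rewrite expn_gt0 (ltn_trans _ M1).
set x := (M ^ b)%N => x0; apply: (@leq_trans (x * 4)); first lia.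
by rewrite leq_mul2l !expnS expn0 muln1 (@leq_mul 2 2) ?orbT.
Qed.


Lemma leq_expWl k m p : (m <= p)%N -> (m ^ k <= p ^ k)%N.
Proof. by case: k => // k; rewrite leq_exp2r. Qed.

(** * The row operation *)

Section RowOperation.
Variables (R : realFieldType) (n e c w : nat) (A : 'I_n -> 'I_n -> R).
Notation M := (2 ^ e)%N.
Notation LL := (enum 'I_n ++ enum 'I_n).
Notation vecs := (map (@unit_vec n)).
Let b (Y : {ffun 'I_n -> int}) (i : 'I_n) : R := lin (A i) Y.
Hypotheses (e0 : (0 < e)%N) (n0 : (0 < n)%N) (nM : (n <= M ^ w)%N).
Hypothesis hA : M%:R ^- c <= bpr A LL LL.

Let M1 : (1 < M)%N. Proof. by rewrite -{1}(expn0 2) ltn_exp2l. Qed.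
Let Mr0 : 0 < (M%:R : R). Proof. by rewrite ltr0n expn_gt0. Qed.
Let Mr2 : 2 <= (M%:R : R). Proof. by rewrite ler_nat. Qed.
Let MX0 k : 0 < (M%:R : R) ^+ k. Proof. by rewrite exprn_gt0. Qed.

(** The number of generators and the height that the linear inverse theorem gives for the exponent
    [c + 1]. *)
Local Notation d := (2 * c.+1)%N.
Local Notation H := (M ^ (4 * c.+1).+1)%N.

Lemma ler_MXV i j : (i <= j)%N -> (M%:R : R) ^- j <= M%:R ^- i.
Proof. by move=> ij; rewrite lef_pV2 ?posrE// ler_weXn2l// (le_trans _ Mr2)// ler1n. Qed.

Lemma pigeonhole_cost (N k t : nat) (x y : R) : 0 <= y ->
  M%:R ^- t <= x -> x <= N%:R * y -> (N <= M ^ k)%N -> M%:R ^- (t + k) <= y.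
Proof.
move=> y0 tx xy Nk; rewrite exprD invfM ler_pdivrMr// mulrC.
apply: le_trans tx _; apply: le_trans xy _.
by rewrite ler_wpM2r// -natrX ler_nat.
Qed.

Definition structured (g : d.-tuple 'I_n) (D : nat) Y i :=
  comb H (map (b Y) g) (b Y i *+ D).

(** For each good [Y] the linear theorem gives generators and a denominator; the most popular choice
    among the n^d M^d possible ones is fixed, and [phi] indicates the good [Y] that admit it. *)
Lemma popular_generators :
  exists (g : d.-tuple 'I_n) (D : nat) (phi : {ffun 'I_n -> int} -> R),
  [/\ (0 < D <= M ^ d)%N, forall Y, 0 <= phi Y <= 1,
      M%:R ^- (c.+1 + (w * d + d)) <= Ex (vecs LL) phi &
      forall Y, phi Y * \sum_i ind R (~ structured g D Y i) <=
                phi Y * (d.+1 * M ^ 2)%:R].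
Proof.
pose rho Y := pr R (map (b Y) LL) 0.
pose good Y := M%:R ^- c.+1 <= rho Y.
(* Values of [Y] that are not good contribute at most M^(-c-1) to the concentration, and M^(-c) is
   at least twice that since [M >= 2]. *)
have Eg : M%:R ^- c.+1 <= Ex (vecs LL) (fun Y => ind R (good Y)).
  have h : Ex (vecs LL) rho <= Ex (vecs LL) (fun Y => ind R (good Y)) + M%:R ^- c.+1.
    rewrite -[X in _ + X](Ex_cst (vecs LL)) -ExD; apply: Ex_mono => Y _.
    have [gY|/negP bY] := pselect (good Y).
      by rewrite ind_true// (le_trans (pr_le1 _ _ _))// lerDl invr_ge0 ltW.
    by rewrite ler_wpDl ?ind_ge0// ltW// ltNge.
  have := hA; rewrite bprE => /le_trans/(_ h); rewrite -lerBlDr.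
  apply: le_trans.
  have -> : M%:R ^- c = M%:R * M%:R ^- c.+1 :> R.
    by rewrite exprS invfM mulrA divff ?mul1r// gt_eqF.
  by rewrite lerBrDr -mulr2n -[leLHS]mulr_natl ler_wpM2r// invr_ge0 ltW.
pose L : finType := (d.-tuple 'I_n * 'I_(M ^ d))%type.
pose Q (l : L) Y := exists E : {set 'I_n}, (#|E| <= d.+1 * M ^ 2)%N /\
  forall i, i \notin E -> structured l.1 l.2.+1 Y i.
pose i0 := Ordinal n0.
have Md : (0 < M ^ d)%N by rewrite !expn_gt0.
have [||[g D]] := @pigeonhole_ind R _ L ([tuple of nseq d i0], Ordinal Md) (vecs LL)
   (fun Y => ind R (good Y)) Q.
- by move=> Y; apply: ind_ge0.
- move=> Y _; have [gY _|bY] := pselect (good Y); last by rewrite ind_false// eqxx.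
  have [g [D [E [sg /andP[D0 Dd] cE hE]]]] := inverse_littlewood_offord e0 gY.
  (* Padding to length [d] makes the generators a label from a finite type; the label for the
     denominator stores [D - 1]. *)
  have sz : size (g ++ nseq (d - size g) i0) == d.
    by rewrite size_cat size_nseq subnKC.
  have lt : (D.-1 < M ^ d)%N by rewrite prednK.
  exists (Tuple sz, Ordinal lt), E; split=> // i iE.
  by rewrite /structured /= prednK// map_cat; apply: comb_catl; apply: hE.
move=> le; exists g, D.+1, (fun Y => ind R (Q (g, D) Y) * ind R (good Y)); split.
- exact: ltn_ord.
- by move=> Y; rewrite mulr_ge0 ?ind_ge0// mulr_ile1 ?ind_ge0// /ind lern1; case: asboolP.
- apply: pigeonhole_cost Eg le _.
    by apply: Ex_ge0 => Y; rewrite mulr_ge0// ind_ge0.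
  by rewrite card_prod card_tuple !card_ord (expnD _ (w * d) d) (expnM _ w d) leq_mul2r leq_exp2r ?nM ?orbT.
- move=> Y; have [[E [cE hE]]|nq] := pselect (Q (g, D) Y); last first.
    by rewrite ind_false// !mul0r.
  rewrite ler_wpM2l ?mulr_ge0 ?ind_ge0//.
  apply: (@le_trans _ _ (\sum_(i in E) 1)); last by rewrite sumr_const ler_nat.
  rewrite [leRHS]big_mkcond; apply: ler_sum => i _; case: ifPn => iE.
    by rewrite /ind lern1; case: asboolP.
  by rewrite ind_false//; apply; apply: hE.
Qed.

Lemma lin_row D (g : d.-tuple 'I_n) (p : 'I_d -> int) i Y :
  lin (fun j => A i j *+ D - \sum_s A (tnth g s) j *~ p s) Y =
  b Y i *+ D - \sum_s b Y (tnth g s) *~ p s.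
Proof.
rewrite /b /lin; under eq_bigr => j _ do rewrite mulrzBl mulrz_suml.
rewrite sumrB exchange_big /= -sumrMnl; congr (_ - _).
  by apply: eq_bigr => j _; rewrite !pmulrn mulrzAC.
apply: eq_bigr => s _; rewrite mulrz_suml.
by apply: eq_bigr => j _; rewrite mulrzAC.
Qed.

(** A row structured for half of the weight satisfies one of boundedly many relations for each such
    [Y]. The most popular relation is linear in [Y], so it is the vanishing of the linear form of
    the modified row. *)
Lemma popular_relation (g : d.-tuple 'I_n) (D t : nat) (phi : {ffun 'I_n -> int} -> R) i :
  (forall Y, 0 <= phi Y <= 1) -> M%:R ^- t <= Ex (vecs LL) phi ->
  Ex (vecs LL) phi <= 2 * Ex (vecs LL) (fun Y => phi Y * ind R (structured g D Y i)) ->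
  exists p : 'I_d -> int, (forall s, (`|p s| <= H)%N) /\
    M%:R ^- (t + 1 + ((4 * c.+1).+1 + 2) * d) <=
    pr R (map (fun j => A i j *+ D - \sum_s A (tnth g s) j *~ p s) LL) 0.
Proof.
move=> phi01 ht hphi.
have h1 : M%:R ^- (t + 1) <= Ex (vecs LL) (fun Y => ind R (structured g D Y i)).
  apply: (@pigeonhole_cost 2 1) ht _ _; last by rewrite expn1.
    by apply: Ex_ge0 => Y; apply: ind_ge0.
  apply: le_trans hphi _; rewrite ler_wpM2l//; apply: Ex_mono => Y _.
  by have /andP[_ h] := phi01 Y; rewrite ler_piMl// ind_ge0.
pose L : finType := {ffun 'I_d -> 'I_(2 * H).+1}.
pose z (l : L) s : int := (l s)%:Z - H%:Z.
pose Q (l : L) Y := b Y i *+ D - \sum_s b Y (tnth g s) *~ z l s = 0.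
have [||l le] := @pigeonhole_ind R _ L [ffun=> ord0] (vecs LL)
   (fun Y => ind R (structured g D Y i)) Q.
- by move=> Y; apply: ind_ge0.
- move=> Y _; have [|bY] := pselect (structured g D Y i); last by rewrite ind_false// eqxx.
  move=> /combP[p [ph eb]] _.
  have /choice[l hl] : forall s : 'I_d, exists l : 'I_(2 * H).+1, p s = l%:Z - H%:Z.
    by move=> s; apply: int_label.
  exists [ffun s => l s]; rewrite /Q eb size_map size_tuple.
  apply/eqP; rewrite subr_eq0; apply/eqP; apply: eq_bigr => s _.
  rewrite /z ffunE -hl; congr (_ *~ _).
  by rewrite (nth_map (tnth g s)) ?size_tuple// -tnth_nth.
exists (z l); split; first by move=> s; have := ltn_ord (l s); rewrite /z; lia.
have h2 : Ex (vecs LL) (fun Y => ind R (Q l Y) * ind R (structured g D Y i)) <=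
    pr R (map (fun j => A i j *+ D - \sum_s A (tnth g s) j *~ z l s) LL) 0.
  rewrite pr_lin; apply: Ex_mono => Y _; rewrite lin_row.
  have [q|nq] := pselect (Q l Y); last by rewrite ind_false// mul0r ler0n.
  by rewrite q eqxx ind_true// mul1r /ind lern1; case: asboolP.
apply: pigeonhole_cost h1 (le_trans le (ler_wpM2l (ler0n _ _) h2)) _; first exact: pr_ge0.
by rewrite card_ffun !card_ord (expnM _ _ d) leq_exp2r// pow_label.
Qed.

(* Substituting the relations of the rows in [I] into the form leaves the linear
   forms of the rows in [I0], with coefficients [z] that are integers of polynomial
   size in the signs: fix the most likely value of [z], and recall that a doubled
   walk is most concentrated at 0. *)
Lemma row_concentration (I0 I : {set 'I_n}) (D k : nat) (kk : 'I_n -> 'I_n -> int)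
    (Q : 'I_n -> 'I_n -> R) :
  [disjoint I & I0] -> (#|I0| <= d)%N -> (0 < D <= M ^ k)%N ->
  (forall i i0, (`|kk i i0| <= M ^ k)%N) ->
  (forall i j, i \in I -> Q i j = A i j *+ D + \sum_(i0 in I0) A i0 j *~ kk i i0) ->
  (forall i j, i \notin I -> Q i j = 0) ->
  M%:R ^- (c + (w + k + 3) * d) <= bpr Q LL LL.
Proof.
move=> dI sI0 /andP[D0 Dk] kkk QI QnI.
(* The variables of rows outside [I] and [I0] are exposed, which does not lower the concentration at
   0. *)
pose L1 := [seq i <- enum 'I_n | i \in I :|: I0].
pose L2 := [seq i <- enum 'I_n | i \notin I :|: I0].
have pL : perm_eq (enum 'I_n) (L1 ++ L2) by rewrite perm_sym; apply/permPl/perm_filterC.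
have h1 : M%:R ^- c <= bpr A (L1 ++ L1) LL.
  apply: le_trans hA _; rewrite !bprE; apply: Ex_mono => Y _.
  have pe : perm_eq (map (fun i => lin (A i) Y) LL)
      ((map (fun i => lin (A i) Y) L1 ++ map (fun i => lin (A i) Y) L2) ++
       (map (fun i => lin (A i) Y) L1 ++ map (fun i => lin (A i) Y) L2)).
    by rewrite -map_cat -map_cat; apply: perm_map; apply: perm_cat.
  by rewrite (pr_perm _ _ pe) (le_trans (pr_drop _ _ _ _))// map_cat.
(* The coefficient of the row form [i0] once every row in [I] is expressed through [Q] and the rows
   in [I0]. *)
pose z i0 (X : {ffun 'I_n -> int}) : int := D%:Z * X i0 - \sum_(i in I) kk i i0 * X i.
have zB i0 : {morph z i0 : X Y / X - Y}.
  move=> X Y; rewrite /z !ffunE.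
  under eq_bigr => i _ do rewrite !ffunE mulrBr.
  by rewrite sumrB; ring.
have z1 i0 i : i0 \in I0 -> (`|z i0 (unit_vec i)| <= M ^ k)%N.
  move=> iI0; rewrite /z ffunE.
  have [iI|iI] := boolP (i \in I).
    have -> : (i0 == i) = false.
      by apply: contraTF iI0 => /eqP ->; rewrite (disjointFr dI iI).
    rewrite mulr0 sub0r (bigD1 i)//= ffunE eqxx mulr1 big1 ?addr0 ?abszN// => l /andP[_ li].
    by rewrite ffunE (negbTE li) mulr0.
  rewrite big1 ?subr0 => [|l lI].
    by case: eqP => _; rewrite ?mulr0// mulr1 absz_nat.
  rewrite ffunE; case: eqP => [li|_]; last by rewrite mulr0.
  by rewrite -li lI in iI.
pose B := (M ^ (w + k + 1))%N.
have zX i0 X : i0 \in I0 -> X \in ssum (vecs (L1 ++ L1)) -> (`|z i0 X| <= B)%N.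
  move=> iI0 XS; apply: leq_trans (ssum_bound (h := (M ^ k)%N) (zB i0) _ XS) _.
    by move=> v /mapP[i _ ->]; apply: z1.
  rewrite size_map size_cat /B addnAC expnD leq_mul2r; apply/orP; right.
  have sL : (size L1 <= n)%N by rewrite size_filter (leq_trans (count_size _ _))// size_enum_ord.
  have : (size L1 <= M ^ w)%N := leq_trans sL nM.
  by rewrite expnD expn1; set x := (M ^ w)%N; set y := size L1; move: M1; nia.
have X0 i X : i \notin I :|: I0 -> X \in ssum (vecs (L1 ++ L1)) -> X i = 0.
  move=> iI XS; apply/eqP; rewrite -absz_eq0 -leqn0.
  have := @ssum_bound _ (fun X : {ffun 'I_n -> int} => X i) _ 0%N X _ _ XS; rewrite muln0; apply.
    by move=> x y; rewrite !ffunE.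
  move=> v /mapP[j]; rewrite mem_cat orbb mem_filter => /andP[jI _] ->.
  by rewrite ffunE; case: eqP => // ij; rewrite ij jI in iI.
pose sI := {i : 'I_n | i \in I0}.
pose L : finType := {ffun sI -> 'I_(2 * B).+1}.
pose val_of (l : L) s : int := (l s)%:Z - B%:Z.
pose P (l : L) X := forall s : sI, z (val s) X = val_of l s.
have h1' : M%:R ^- c <= Ex (vecs (L1 ++ L1)) (fun X => pr R (map (fun j => lin (A^~ j) X) LL) 0).
  exact: h1.
have [||l le] := @pigeonhole_ind R _ L [ffun=> ord0] (vecs (L1 ++ L1))
   (fun X => pr R (map (fun j => lin (A^~ j) X) LL) 0) P.
- by move=> X; apply: pr_ge0.
- move=> X XS _.
  have /choice[l hl] : forall s : sI, exists l : 'I_(2 * B).+1, z (val s) X = l%:Z - B%:Z.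
    by move=> s; apply: int_label; apply: zX XS; apply: valP.
  by exists [ffun s => l s] => s; rewrite /val_of ffunE.
pose K Y := \sum_(s : sI) b Y (val s) *~ val_of l s.
have key X Y : P l X -> X \in ssum (vecs (L1 ++ L1)) ->
    lin (fun i => lin (A i) Y) X *+ D = lin (fun i => lin (Q i) Y) X + K Y.
  move=> PX XS.
  have -> : K Y = \sum_(i0 in I0) b Y i0 *~ z i0 X.
    rewrite (big_sub I0 (fun i0 => b Y i0 *~ z i0 X)); apply: eq_bigr => s _.
    by rewrite PX.
  have bQ i : i \in I -> lin (Q i) Y = b Y i *+ D + \sum_(i0 in I0) b Y i0 *~ kk i i0.
    move=> iI; rewrite /b /lin; under eq_bigr => j _ do rewrite (QI _ _ iI) mulrzDl mulrz_suml.
    rewrite big_split exchange_big /= -sumrMnl; congr (_ + _).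
      by apply: eq_bigr => j _; rewrite !pmulrn mulrzAC.
    apply: eq_bigr => i0 _; rewrite mulrz_suml.
    by apply: eq_bigr => j _; rewrite mulrzAC.
  have bQ0 i : i \notin I -> lin (Q i) Y = 0.
    by move=> iI; rewrite /lin big1// => j _; rewrite QnI// mul0rz.
  have linE (F : 'I_n -> R) (X' : {ffun 'I_n -> int}) : lin F X' = \sum_i F i *~ X' i :> R by [].
  rewrite (linE (fun i => lin (A i) Y)) (linE (fun i => lin (Q i) Y)).
  rewrite (bigID (mem I)) /= [in RHS](bigID (mem I)) /=.
  rewrite [X in _ = _ + X + _]big1 ?addr0 => [|i /bQ0 ->]; last by rewrite mul0rz.
  have -> : \sum_(i | i \notin I) lin (A i) Y *~ X i = \sum_(i0 in I0) b Y i0 *~ X i0.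
    rewrite [RHS]big_mkcond [LHS]big_mkcond /=; apply: eq_bigr => i _.
    have [iI|iI] := boolP (i \in I); first by rewrite (disjointFr dI iI).
    by case: ifPn => // iI0; rewrite X0 ?mulr0z// !inE negb_or iI.
  rewrite /z; under [X in _ = _ + X]eq_bigr => i0 _ do rewrite mulrzBr.
  have e1 : \sum_(i0 in I0) b Y i0 *~ (D%:Z * X i0) = (\sum_(i0 in I0) b Y i0 *~ X i0) *+ D.
    by rewrite -sumrMnl; apply: eq_bigr => i0 _; rewrite !pmulrn mulrzA mulrzAC.
  have e2 : \sum_(i in I) lin (Q i) Y *~ X i = (\sum_(i in I) lin (A i) Y *~ X i) *+ D +
      \sum_(i0 in I0) b Y i0 *~ (\sum_(i in I) kk i i0 * X i).
    under eq_bigr => i iI do rewrite bQ// mulrzDl.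
    rewrite big_split -sumrMnl; congr (_ + _).
      by apply: eq_bigr => i _; rewrite !pmulrn mulrzAC.
    under eq_bigr => i _ do rewrite mulrz_suml.
    rewrite exchange_big; apply: eq_bigr => i0 _ /=; rewrite mulrz_sumr.
    by apply: eq_bigr => i _; rewrite mulrzA.
  by rewrite sumrB e1 e2 mulrnDl -addrA; congr (_ + _); rewrite addrC subrK.
have h2 : Ex (vecs (L1 ++ L1)) (fun X => ind R (P l X) * pr R (map (fun j => lin (A^~ j) X) LL) 0)
    <= bpr Q LL LL.
  have -> : bpr Q LL LL = Ex (vecs LL) (fun Y => pr R (map (fun i => lin (Q i) Y) (L1 ++ L1)) 0).
    rewrite bprE; apply: eq_Ex => Y.
    rewrite /pr -Ex_filter_neq0 -[RHS]Ex_filter_neq0; congr Ex.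
    have ef s : [seq i <- s | lin (Q i) Y != 0] =
        [seq i <- [seq i <- s | i \in I :|: I0] | lin (Q i) Y != 0].
      rewrite -filter_predI; apply: eq_filter => i /=; rewrite !inE.
      have [iI|iI] := boolP (i \in I); rewrite ?andbT//= [lin _ _]big1 ?eqxx// => j _.
      by rewrite QnI// mul0rz.
    rewrite !filter_map !filter_cat map_cat [RHS]map_cat.
    by congr (_ ++ _); congr map; apply: ef.
  (* For fixed [z] the target [- K Y] depends on [Y] alone, so after exchanging expectations it is a
     fixed point for the doubled walk in [X]. *)
  apply: (@le_trans _ _ (Ex (vecs (L1 ++ L1)) (fun X => Ex (vecs LL) (fun Y =>
     (lin (fun i => lin (Q i) Y) X == - K Y)%:R)))).
    apply: Ex_mono => X XS; have [PX|nP] := pselect (P l X); last first.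
      by rewrite ind_false// mul0r; apply: Ex_ge0 => Y; apply: ler0n.
    rewrite ind_true// mul1r pr_lin; apply: Ex_mono => Y _.
    rewrite ler_nat lin_exch; case: eqP => // e1; case: eqP => // e2; case: e2.
    by have := key _ Y PX XS; rewrite e1 mul0rn => /esym/eqP; rewrite addr_eq0 => /eqP.
  rewrite Ex_exch; apply: Ex_mono => Y _; rewrite -pr_lin map_cat.
  exact: pr_dbl_max.
apply: pigeonhole_cost h1' (le_trans le (ler_wpM2l (ler0n _ _) h2)) _.
  by apply: Ex_ge0 => X; apply: pr_ge0.
have -> : #|L| = ((2 * B).+1 ^ #|I0|)%N by rewrite card_ffun card_ord card_sig.
have hB : ((2 * B).+1 <= M ^ (w + k + 3))%N.
  have -> : (w + k + 3 = w + k + 1 + 2)%N by lia.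
  exact: pow_label.
apply: leq_trans (leq_expWl _ hB) _.
by rewrite (expnM _ _ d); apply: leq_pexp2l; rewrite ?expn_gt0// (ltn_trans _ M1).
Qed.

(** A single exponent dominating every loss and every size bound in [row_operation]. *)
Definition row_exponent : nat :=
  (c.+1 + (w * d + d) + 1 + ((4 * c.+1).+1 + 2) * d +
   (c + (w + (d + (4 * c.+1).+1) + 3) * d) + (d + (4 * c.+1).+1) + 3 * d + 2)%N.

(** The popular generators become [I0]. Averaging over [Y] gives all but few rows a popular
    relation, which makes each of them concentrated; [row_concentration] handles the whole form. *)
Lemma row_operation : exists (I0 I : {set 'I_n}) (D : nat) (kk : 'I_n -> 'I_n -> int)
    (Q : 'I_n -> 'I_n -> R),
  [/\ (#|I0| <= d)%N, (#|~: I| <= row_exponent * M ^ 2)%N, [disjoint I & I0],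
      (0 < D <= M ^ row_exponent)%N &
      forall i i0, (`|kk i i0| <= M ^ row_exponent)%N] /\
  [/\ forall i j, i \in I -> Q i j = A i j *+ D + \sum_(i0 in I0) A i0 j *~ kk i i0,
      forall i j, i \notin I -> Q i j = 0,
      forall i, M%:R ^- row_exponent <= pr R (map (Q i) LL) 0 &
      M%:R ^- row_exponent <= bpr Q LL LL].
Proof.
have [g [D [phi [/andP[D0 Dd] phi01 hphi few]]]] := popular_generators.
set t := (c.+1 + _)%N in hphi.
pose Ephi := Ex (vecs LL) phi.
have Ephi0 : 0 < Ephi by apply: lt_le_trans hphi; rewrite invr_gt0.
pose E1 i := Ex (vecs LL) (fun Y => phi Y * ind R (structured g D Y i)).
pose E2 i := Ex (vecs LL) (fun Y => phi Y * ind R (~ structured g D Y i)).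
have E12 i : Ephi = E1 i + E2 i.
  rewrite -ExD; apply: eq_Ex => Y; rewrite -mulrDr.
  have [h|h] := pselect (structured g D Y i).
    by rewrite ind_true// ind_false ?addr0 ?mulr1//; apply.
  by rewrite ind_false// ind_true// add0r mulr1.
(* Rows structured for less than half of the weight; double counting against the unstructured pairs
   bounds their number. *)
pose Bad := [set i | 2 * E1 i < Ephi].
have cBad : (#|Bad| <= 2 * (d.+1 * M ^ 2))%N.
  have h1 : \sum_i E2 i <= Ephi * (d.+1 * M ^ 2)%:R.
    rewrite -Ex_sum /Ephi mulrC -ExZ; apply: Ex_mono => Y _.
    by rewrite -mulr_sumr [leRHS]mulrC.
  have h2 : \sum_(i in Bad) (Ephi / 2) <= \sum_i E2 i.
    rewrite big_mkcond; apply: ler_sum => i _; case: ifPn => [|_].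
      by rewrite inE; have := E12 i; lra.
    apply: Ex_ge0 => Y; have /andP[h _] := phi01 Y; rewrite mulr_ge0// ind_ge0.
  move: (le_trans h2 h1); rewrite sumr_const -mulr_natr.
  move=> h3; have : Ephi * #|Bad|%:R <= Ephi * (2 * (d.+1 * M ^ 2))%:R.
    by rewrite (natrM _ 2); lra.
  by rewrite ler_pM2l// ler_nat.
pose I0 := [set tnth g s | s in 'I_d].
pose I := ~: (Bad :|: I0).
have /choice[p hp] : forall i, exists p : 'I_d -> int, i \in I ->
    (forall s, (`|p s| <= H)%N) /\
    M%:R ^- (t + 1 + ((4 * c.+1).+1 + 2) * d) <=
    pr R (map (fun j => A i j *+ D - \sum_s A (tnth g s) j *~ p s) LL) 0.
  move=> i; have [iB|iB] := boolP (i \in Bad).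
    by exists (fun=> 0); rewrite !inE in iB *; rewrite iB.
  have h : Ephi <= 2 * E1 i by move: iB; rewrite inE -leNgt.
  by have [p hp] := popular_relation phi01 hphi h; exists p.
(* The tuple [g] may repeat an index, so the coefficients of equal generators are added; the sign
   turns the relation into a sum. *)
pose kk i i0 : int := if i \in I then - \sum_(s | tnth g s == i0) p i s else 0.
pose Q i j : R := if i \in I then A i j *+ D + \sum_(i0 in I0) A i0 j *~ kk i i0 else 0.
pose k := (d + (4 * c.+1).+1)%N.
have kkk i i0 : (`|kk i i0| <= M ^ k)%N.
  rewrite /kk; case: ifPn => // iI; rewrite abszN.
  have ps s : (`|p i s| <= H)%N by have [] := hp i iI.
  apply: (@leq_trans (\sum_(s < d) H)).
    rewrite big_mkcond /=; elim/big_ind2: _ => // [x x' y y' h h'|s _].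
      by apply: leq_trans (leq_add h h'); lia.
    by case: ifP.
  by rewrite sum_nat_const card_ord expnD leq_mul2r (ltnW (ltn_expl _ M1)) orbT.
have QE i j : i \in I -> Q i j = A i j *+ D - \sum_s A (tnth g s) j *~ p i s.
  move=> iI; rewrite /Q iI; congr (_ + _).
  rewrite (partition_big (tnth g) (mem I0)) /=; last by move=> s _; apply: imset_f.
  rewrite -sumrN; apply: eq_bigr => i0 _; rewrite /kk iI mulrNz mulrz_sumr.
  by congr (- _); apply: eq_bigr => s /eqP ->.
have cI0 : (#|I0| <= d)%N by rewrite (leq_trans (leq_imset_card _ _))// card_ord.
have dI : [disjoint I & I0].
  by rewrite disjoints_subset /I setCU subsetIr.
have wk a b' : (a <= b')%N -> (M ^ a <= M ^ b')%N.
  by move=> ab; apply: leq_pexp2l => //; rewrite expn_gt0.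
exists I0, I, D, kk, Q; split; split => //.
- rewrite setCK; apply: leq_trans (leq_card_setU _ _) _.
  have M2 : (0 < M ^ 2)%N by rewrite !expn_gt0.
  apply: (@leq_trans (2 * (d.+1 * M ^ 2) + d * M ^ 2)).
    by apply: leq_add cBad (leq_trans cI0 _); rewrite leq_pmulr.
  by rewrite mulnA -mulnDl leq_mul2r; apply/orP; right; rewrite /row_exponent; lia.
- by rewrite D0 (leq_trans Dd)// wk// /row_exponent; lia.
- by move=> i i0; rewrite (leq_trans (kkk i i0))// wk// /row_exponent /k; lia.
- by move=> i j iI; rewrite /Q iI.
- by move=> i j iI; rewrite /Q (negbTE iI).
(* Rows outside [I] were set to zero, so their forms vanish with probability 1. *)
- move=> i; have [iI|iI] := boolP (i \in I); last first.
    rewrite pr_lin (@eq_Ex _ _ _ _ (fun=> 1)) ?Ex_cst.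
      by rewrite invf_le1// exprn_ege1// (le_trans _ Mr2)// ler1n.
    move=> Y; rewrite [lin _ _]big1 ?eqxx// => j _.
    by rewrite /Q (negbTE iI) mul0rz.
  have [_] := hp i iI; rewrite (eq_map (QE i ^~ iI)); apply: le_trans.
  by apply: ler_MXV; rewrite /row_exponent /t; lia.
- apply: le_trans (row_concentration (D := D) (k := k) dI cI0 _ kkk _ _).
  + by apply: ler_MXV; rewrite /row_exponent /k; lia.
  + by rewrite D0 (leq_trans Dd)// wk// /k; lia.
  + by move=> i j iI; rewrite /Q iI.
  + by move=> i j iI; rewrite /Q (negbTE iI).
Qed.

End RowOperation.

(** * Common generators *)

Section RationalSpan.
Variables (R : realFieldType) (M : nat).
Hypothesis M1 : (1 < M)%N.
Implicit Types (G : seq R) (v : R) (a b : nat).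

(** Rational combinations with a common denominator; one exponent [b] measures both the denominator
    and the height. *)
Definition rspan b G v : Prop :=
  exists q : int, [/\ q != 0, (`|q| <= M ^ b)%N & comb (M ^ b) G (v *~ q)].

Let wk a b : (a <= b)%N -> (M ^ a <= M ^ b)%N.
Proof. by move=> ab; apply: leq_pexp2l => //; rewrite (ltn_trans _ M1). Qed.

Lemma rspan_le a b G v : (a <= b)%N -> rspan a G v -> rspan b G v.
Proof.
move=> /wk ab [q [q0 qa h]]; exists q; split=> //; first exact: leq_trans ab.
exact: comb_le h.
Qed.

Lemma rspan0 b G : rspan b G 0.
Proof. by exists 1; split; rewrite ?expn_gt0 ?(ltn_trans _ M1)// mul0rz; apply: comb0. Qed.

Lemma rspanD a b G v w : rspan a G v -> rspan b G w -> rspan (a + b).+1 G (v + w).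
Proof.
move=> [q [q0 qa hv]] [r [r0 rb hw]]; exists (q * r); split.
- by rewrite mulf_neq0.
- by rewrite abszM (leq_trans (leq_mul qa rb))// -expnD wk.
rewrite mulrzDl mulrzA [q * r]mulrC [w *~ _]mulrzA.
apply: comb_le (combD (combZ r hv) (combZ q hw)).
have h1 : (`|r| * M ^ a <= M ^ (a + b))%N by rewrite expnD mulnC leq_mul2l rb orbT.
have h2 : (`|q| * M ^ b <= M ^ (a + b))%N by rewrite expnD leq_mul2r qa orbT.
apply: leq_trans (leq_add h1 h2) _.
by rewrite addnn -mul2n expnS leq_mul2r M1 orbT.
Qed.

Lemma rspanZ a b G v (z : int) : (`|z| <= M ^ a)%N -> rspan b G v -> rspan (b + a) G (v *~ z).
Proof.
move=> za [q [q0 qb hv]]; exists q; split=> //.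
  by apply: leq_trans qb (wk _); rewrite leq_addr.
rewrite mulrzAC; apply: comb_le (combZ z hv).
by rewrite expnD mulnC leq_mul2l za orbT.
Qed.

Lemma rspanN b G v : rspan b G v -> rspan b G (- v).
Proof.
move=> h; have /(rspanZ (a := 0) (z := -1)) : rspan b G v by [].
by rewrite addn0 mulrNz mulr1z; apply.
Qed.

Lemma rspan_div a b G v (z : int) : z != 0 -> (`|z| <= M ^ a)%N ->
  rspan b G (v *~ z) -> rspan (b + a) G v.
Proof.
move=> z0 za [q [q0 qb hv]]; exists (z * q); split.
- by rewrite mulf_neq0.
- by rewrite abszM mulnC expnD leq_mul.
by rewrite mulrzA; apply: comb_le hv; apply: wk; rewrite leq_addr.
Qed.

Lemma rspan_catl b G G' v : rspan b G v -> rspan b (G ++ G') v.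
Proof. by move=> [q [q0 qb h]]; exists q; split=> //; apply: comb_catl. Qed.

Lemma rspan_catr b G G' v : rspan b G' v -> rspan b (G ++ G') v.
Proof. by move=> [q [q0 qb h]]; exists q; split=> //; apply: comb_catr. Qed.

Lemma rspan_flatten b (Gs : seq (seq R)) G v :
  G \in Gs -> rspan b G v -> rspan b (flatten Gs) v.
Proof.
elim: Gs => //= G' Gs IH; rewrite inE => /predU1P[->|/IH h]; first exact: rspan_catl.
by move=> /h; apply: rspan_catr.
Qed.

End RationalSpan.

Section IntegerWalk.
Variables (R : realFieldType).

Definition Ez (N : nat) (f : int -> R) : R := Ex (nseq N (1 : int)) f.

Lemma Ex_nseqE (V : zmodType) N (u : V) f : Ex (nseq N u) f = Ez N (fun x => f (u *~ x)).
Proof.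
rewrite /Ez -(Ex_map _ _ (phi := fun x : int => u *~ x)); last by move=> x y; rewrite mulrzBr.
by rewrite map_nseq mulr1z.
Qed.

Lemma ssum_nseq1 N (x : int) : x \in ssum (nseq N (1 : int)) -> (`|x| <= N)%N.
Proof.
move=> xs; have := @ssum_bound _ id (nseq N 1) 1 x (fun x y => erefl) _ xs.
by rewrite size_nseq muln1; apply => w; rewrite mem_nseq => /andP[_ /eqP ->].
Qed.

(** Two positions of the walk with values in the span would put a multiple of [theta] by
    [2 * (j - j') <= M ^ 3] in a slightly larger span, and after division [theta] itself. *)
Lemma Ez_rspan_single M b N (G : seq R) (theta delta : R) : (1 < M)%N ->
  (2 * N <= M ^ 3)%N -> ~ rspan M (2 * b + 4) G theta ->
  Ez N (fun x => ind R (rspan M b G (delta + theta *~ x))) ^+ 2 * N.+1%:R <= 1.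
Proof.
move=> M1 NM nth; rewrite /Ez.
have [|x hx] := @Ex_nseq_single R int N 1 (fun x => ind R (rspan M b G (delta + theta *~ x))).
  move=> j j' jN j'j hj hj'.
  have indE P : ind R P != 0 -> P.
    by move=> h; apply: contrapT => nP; rewrite ind_false ?eqxx in h.
  move/indE: hj => h; move/indE: hj' => h'; apply: nth.
  have := rspanD M1 h (rspanN M1 h').
  set z := 1 *+ j *+ 2 - 1 *+ N; set z' := 1 *+ j' *+ 2 - 1 *+ N.
  have -> : delta + theta *~ z - (delta + theta *~ z') = theta *~ (z - z').
    by rewrite opprD addrACA subrr add0r -mulrzBr.
  have zz : z - z' = (2 * (j - j'))%:Z by rewrite /z /z'; lia.
  move=> /(rspan_div M1 (a := 3)) hd.
  have -> : (2 * b + 4 = (b + b).+1 + 3)%N by lia.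
  by apply: hd; rewrite zz; lia.
apply: le_trans hx _; rewrite expr_le1// ?ind_ge0// /ind lern1; by case: asboolP.
Qed.

End IntegerWalk.

Section LinExtra.
Variables (R : realFieldType) (n : nat).
Implicit Types (c : 'I_n -> R) (X Y : {ffun 'I_n -> int}).

Lemma linD c X Y : lin c (X + Y) = lin c X + lin c Y.
Proof.
rewrite /lin -big_split; apply: eq_bigr => i _ /=.
by rewrite !ffunE mulrzDr.
Qed.

Lemma lin_unitZ c i x : lin c (unit_vec i *~ x) = c i *~ x.
Proof. by rewrite (morphB_mulrz (@linB _ _ c)) lin_unit. Qed.

Lemma lin_addZ (a c : 'I_n -> R) x Y :
  lin (fun j => a j + c j *~ x) Y = lin a Y + lin c Y *~ x.
Proof.
rewrite /lin mulrz_suml -big_split; apply: eq_bigr => j _ /=.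
by rewrite mulrzDl mulrzAC.
Qed.

End LinExtra.

(** * Exposing the chosen pairs one at a time *)

Section Walks.
Variables (R : realFieldType) (n e : nat) (B : 'I_n -> 'I_n -> R).
Hypothesis e0 : (0 < e)%N.
Notation M := (2 ^ e)%N.
Notation N := (M + M)%N.
Notation vecs := (map (@unit_vec n)).
Notation state := (seq ('I_n * 'I_n)).
Implicit Types (st : state) (al be : 'I_n -> R) (G : seq R).

Let M1 : (1 < M)%N. Proof. by rewrite -{1}(expn0 2) ltn_exp2l. Qed.

(* The probability that the affine bilinear form vanishes, the pairs being exposed
   from the head (the most recent) on: [al], [be] and [ga] collect what the exposed
   variables contribute to the coefficients of the others. *)
Fixpoint Phi st al be (ga : R) : R :=
  if st is p :: st' then
    Ez N (fun x => Ez N (fun y =>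
      Phi st' (fun j => al j + B p.1 j *~ x) (fun i => be i + B i p.2 *~ y)
        (ga + B p.1 p.2 *~ (x * y) + al p.2 *~ y + be p.1 *~ x)))
  else (ga == 0)%:R.

Lemma PhiE st al be ga :
  Ex (vecs (flatten [seq nseq N p.1 | p <- st])) (fun X =>
    Ex (vecs (flatten [seq nseq N p.2 | p <- st])) (fun Y =>
      (lin (fun i => lin (B i) Y) X + lin al Y + lin be X + ga == 0)%:R)) =
  Phi st al be ga.
Proof.
elim: st al be ga => [|[i j] st IH] al be ga.
  rewrite /= !Ex_nil; have l0 c : lin c (0 : {ffun 'I_n -> int}) = 0 :> R.
    by rewrite [lin _ _]big1// => i _; rewrite ffunE mulr0z.
  by rewrite !l0 !add0r.
rewrite /= !map_cat !map_nseq Ex_cat Ex_nseqE; apply: eq_Ex => x.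
under eq_Ex => X do rewrite Ex_cat Ex_nseqE.
rewrite Ex_exch; apply: eq_Ex => y; rewrite -IH.
apply: eq_Ex => X; apply: eq_Ex => Y; congr (_ == _)%:R.
rewrite !lin_addZ !linD !lin_unitZ linD lin_unitZ /=.
have -> : lin (fun i0 => lin (B i0) (unit_vec j *~ y + Y)) X =
   lin (fun i => lin (B i) Y) X + lin (B^~ j) X *~ y.
  rewrite -lin_addZ; congr lin; apply/funext => i0.
  by rewrite linD lin_unitZ addrC.
rewrite mulrzDl -mulrzA [y * x]mulrC.
move: (B i j *~ _) (lin (B i) Y *~ x) (lin _ X) (lin _ X *~ y) (al j *~ y)
  (lin al Y) (be i *~ x) (lin be X) => *; ring.
Qed.

Lemma Ez_neq0 k (f : int -> R) : Ez k f != 0 -> exists x, (`|x| <= k)%N /\ f x != 0.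
Proof.
move=> h; apply: contrapT => none; move/eqP: h; apply.
rewrite /Ez -[RHS](Ex_cst (nseq k (1 : int))); apply: eq_Ex_in => x xs.
apply: contrapT => /eqP fx; apply: none; exists x; split=> //.
exact: ssum_nseq1.
Qed.

Lemma NM2 : (N <= M ^ 2)%N.
Proof. by rewrite addnn -mul2n !expnS expn0 muln1 leq_mul2r M1 orbT. Qed.

(** Dominates the recursion E(k + 1, a) = E(k, a + b + 3) + 2 a + b + 11 met in [Phi_support]. *)
Definition span_exponent b a k := (k * (2 * (a + k * (b + 3)) + b + 11))%N.

(** A positive probability means that some signs make the form vanish; then [ga] is minus the sum of
    the other terms, all of which lie in the span. *)
Lemma Phi_support b a st G al be ga :
  (forall p q, p \in st -> q \in st -> rspan M b G (B p.1 q.2)) ->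
  (forall p, p \in st -> rspan M a G (al p.2) /\ rspan M a G (be p.1)) ->
  Phi st al be ga != 0 -> rspan M (span_exponent b a (size st)) G ga.
Proof.
elim: st a al be ga => [|p st IH] a al be ga hB hab.
  rewrite /=; have [-> _|_] := eqVneq ga 0; last by rewrite eqxx.
  exact: rspan0.
move=> /Ez_neq0[x [xN]] /Ez_neq0[y [yN]] h.
have xM : (`|x| <= M ^ 2)%N := leq_trans xN NM2.
have yM : (`|y| <= M ^ 2)%N := leq_trans yN NM2.
have pp := hB _ _ (mem_head p st) (mem_head p st).
have [alp bep] := hab _ (mem_head p st).
have sub q : q \in st -> q \in p :: st by move=> qs; rewrite inE qs orbT.
have := IH (a + (b + 2)).+1 _ _ _ _ _ h.
move=> /(_ (fun p' q' hp hq => hB _ _ (sub _ hp) (sub _ hq))) ih.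
have {}ih := ih _.
have t1 : rspan M (b + 4) G (B p.1 p.2 *~ (x * y)).
  apply: rspanZ => //; rewrite abszM (_ : M ^ 4 = M ^ 2 * M ^ 2)%N ?leq_mul//.
  by rewrite -expnD.
have t2 := rspanZ M1 yM alp.
have t3 := rspanZ M1 xM bep.
have := rspanD M1 (rspanD M1 (rspanD M1 (ih _) (rspanN M1 t1)) (rspanN M1 t2)) (rspanN M1 t3).
have -> : ga + B p.1 p.2 *~ (x * y) + al p.2 *~ y + be p.1 *~ x -
   B p.1 p.2 *~ (x * y) - al p.2 *~ y - be p.1 *~ x = ga.
  move: (B p.1 p.2 *~ _) (al _ *~ _) (be _ *~ _) => *; ring.
move=> h'; apply: rspan_le (h' _) => //.
  rewrite /span_exponent /=; nia.
move=> q qs; have [alq beq] := hab _ (sub _ qs); split.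
  by apply: rspanD => //; apply: rspanZ => //; apply: hB; rewrite ?mem_head ?sub.
by apply: rspanD => //; apply: rspanZ => //; apply: hB; rewrite ?mem_head ?sub.
Qed.

(** Twice (2M)^(-1/2), with the exponent rounded to an integer so that the value only grows. *)
Definition step_prob : R := 2 ^- (e.-1)./2.

Lemma step_prob_ge0 : 0 <= step_prob.
Proof. by rewrite invr_ge0 exprn_ge0. Qed.

Lemma sqr_half_le (x : R) : x ^+ 2 * N.+1%:R <= 1 -> x <= step_prob / 2.
Proof.
move=> h; apply: sqr_le_sqr; first by rewrite divr_ge0 ?step_prob_ge0.
have N0 : 0 < N.+1%:R :> R by rewrite ltr0n.
rewrite -(ler_pM2r N0); apply: le_trans h _.
rewrite /step_prob exprMn -!exprVn -!exprM -exprD.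
have lt : ((e.-1)./2 * 2 + 1 * 2 <= e.+1)%N.
  by have := odd_double_half e.-1; have := e0; lia.
rewrite exprVn mulrC ler_pdivlMr ?exprn_gt0// mul1r -natrX ler_nat.
apply: leq_trans (leq_pexp2l _ lt) _ => //.
by rewrite expnS mul2n -addnn leqnSn.
Qed.

(** For fixed [x] the coefficient of [y] is [al + theta *~ x]. It is rarely in the intermediate span
    because [theta] is outside the largest one; otherwise few [y] bring the value into the smallest
    span. *)
Lemma Ez_bilinear_rspan f G (theta al be ga : R) : ~ rspan M (2 * (2 * f + 4) + 4) G theta ->
  Ez N (fun x => Ez N (fun y =>
    ind R (rspan M f G (ga + theta *~ (x * y) + al *~ y + be *~ x)))) <= step_prob.
Proof.
move=> nth.
have N3 : (2 * N <= M ^ 3)%N by rewrite (expnS _ 2) leq_mul// NM2.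
pose S x := ind R (rspan M (2 * f + 4) G (al + theta *~ x)).
have h1 : Ez N S <= step_prob / 2 by apply: sqr_half_le; apply: Ez_rspan_single.
apply: (@le_trans _ _ (Ez N (fun x => S x + step_prob / 2))).
  apply: Ex_mono => x _.
  have -> : (fun y => ind R (rspan M f G (ga + theta *~ (x * y) + al *~ y + be *~ x))) =
     (fun y => ind R (rspan M f G ((ga + be *~ x) + (al + theta *~ x) *~ y))).
    apply/funext => y; congr (ind R (rspan M f G _)).
    rewrite mulrzDl -mulrzA; move: (theta *~ _) (al *~ _) (be *~ _) => *; ring.
  have [sx|nsx] := pselect (rspan M (2 * f + 4) G (al + theta *~ x)).
    rewrite /S ind_true// -[leLHS]addr0 lerD ?divr_ge0 ?step_prob_ge0//.
    rewrite -[leRHS](Ex_cst (nseq N (1 : int))); apply: Ex_mono => y _.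
    by rewrite /ind lern1; case: asboolP.
  rewrite /S ind_false// add0r; apply: sqr_half_le.
  exact: Ez_rspan_single.
rewrite /Ez ExD Ex_cst -/(Ez N S); move: h1; lra.
Qed.

Variables (b : nat) (Grow Gcol : 'I_n -> seq R).

Definition gens_of st : seq R := flatten [seq Grow p.1 ++ Gcol p.2 | p <- st].

Lemma gens_row a st p v : p \in st -> rspan M a (Grow p.1) v -> rspan M a (gens_of st) v.
Proof.
move=> ps h; apply: (@rspan_flatten _ _ _ _ (Grow p.1 ++ Gcol p.2)).
  by apply/mapP; exists p.
exact: rspan_catl.
Qed.

Lemma gens_col a st p v : p \in st -> rspan M a (Gcol p.2) v -> rspan M a (gens_of st) v.
Proof.
move=> ps h; apply: (@rspan_flatten _ _ _ _ (Grow p.1 ++ Gcol p.2)).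
  by apply/mapP; exists p.
exact: rspan_catr.
Qed.

(** Entries joining a new row or column to an old pair are spanned by the generators of that pair;
    only the corner [B p.1 p.2] escapes the older span. *)
Fixpoint generic bs st : Prop :=
  if st is p :: st' then
    [/\ generic bs st', ~ rspan M bs (gens_of st') (B p.1 p.2),
        rspan M b (Grow p.1) (B p.1 p.2) &
        forall q, q \in st' ->
          rspan M b (Gcol q.2) (B p.1 q.2) /\ rspan M b (Grow q.1) (B q.1 p.2)]
  else True.

Lemma generic_entries bs st : generic bs st ->
  forall p q, p \in st -> q \in st -> rspan M b (gens_of st) (B p.1 q.2).
Proof.
elim: st => //= r st IH [/IH ih _ hr hq] p q; rewrite !inE.
move=> /predU1P[->|ps] /predU1P[->|qs].
- by apply: (gens_row (mem_head r st)).
- apply: rspan_catr; have [h _] := hq _ qs; exact: gens_col qs h.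
- apply: rspan_catr; have [_ h] := hq _ ps; exact: gens_row ps h.
- by apply: rspan_catr; apply: ih.
Qed.

(** What exposed pairs add to the later coefficients must lie in the span of the pairs behind the
    head; the head itself may carry arbitrary coefficients, as [Ez_bilinear_rspan] allows. *)
Fixpoint absorbed a st al be : Prop :=
  if st is p :: st' then
    absorbed a st' al be /\ forall q, q \in st' ->
      rspan M a (gens_of st') (al q.2) /\ rspan M a (gens_of st') (be q.1)
  else True.

Lemma absorbed_update a st p al be x y :
  (`|x| <= M ^ 2)%N -> (`|y| <= M ^ 2)%N ->
  (forall q, q \in st -> rspan M b (Gcol q.2) (B p.1 q.2) /\ rspan M b (Grow q.1) (B q.1 p.2)) ->
  absorbed a st al be ->
  absorbed (a + (b + 2)).+1 st (fun j => al j + B p.1 j *~ x) (fun i => be i + B i p.2 *~ y).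
Proof.
move=> xM yM; elim: st => //= r st IH hq [hst hr]; split.
  by apply: IH => // q qs; apply: hq; rewrite inE qs orbT.
move=> q qs; have [h1 h2] := hr _ qs.
have [h3 h4] : rspan M b (Gcol q.2) (B p.1 q.2) /\ rspan M b (Grow q.1) (B q.1 p.2).
  by apply: hq; rewrite inE qs orbT.
split; apply: rspanD => //; apply: rspanZ => //.
  exact: gens_col h3.
exact: gens_row h4.
Qed.

Lemma absorbed0 st : absorbed 0 st (fun=> 0) (fun=> 0).
Proof. by elim: st => //= p st IH; split=> // q _; split; apply: rspan0. Qed.

(** The bound on [a] leaves room for the growth by [b + 3] at each remaining pair, so the exponent
    for [m] pairs serves at every stage. *)
Lemma Phi_bound m bs a st al be ga :
  (2 * (2 * span_exponent b 0 m + 4) + 4 <= bs)%N ->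
  (a + size st * (b + 3) <= m * (b + 3))%N -> (size st <= m)%N ->
  generic bs st -> absorbed a st al be ->
  Phi st al be ga <= step_prob ^+ size st.
Proof.
move=> hbs; elim: st a al be ga => [|p st IH] a al be ga ham sm.
  by move=> _ _; rewrite /= expr0 lern1; case: eqP.
move=> [gst np hp hq] [ast hab].
rewrite [Phi _ _ _ _]/= [size _]/= exprSr.
set f := span_exponent b 0 m in hbs *.
have np' : ~ rspan M (2 * (2 * f + 4) + 4) (gens_of st) (B p.1 p.2).
  by move=> h; apply: np; apply: rspan_le h.
have := Ez_bilinear_rspan (al p.2) (be p.1) ga np'.
set E := Ez _ _ => hE.
apply: (@le_trans _ _ (step_prob ^+ size st * E)); last first.
  by rewrite ler_wpM2l// exprn_ge0// step_prob_ge0.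
rewrite /E /Ez -ExZ; apply: Ex_mono => x /ssum_nseq1 xN.
rewrite -ExZ; apply: Ex_mono => y /ssum_nseq1 yN.
have xM : (`|x| <= M ^ 2)%N := leq_trans xN NM2.
have yM : (`|y| <= M ^ 2)%N := leq_trans yN NM2.
set al' := fun j => _; set be' := fun i => _; set ga' := _ + _ *~ x.
have abs' := absorbed_update xM yM hq ast.
(* If the new constant is in the older span, recurse, at a cost already bounded by [hE]; if not,
   [Phi_support] makes the remaining probability zero. *)
have [h|h] := pselect (rspan M f (gens_of st) ga').
  rewrite ind_true// mulr1; apply: (IH (a + (b + 2)).+1) => //.
  - by move: ham; rewrite /=; nia.
  - exact: ltnW.
rewrite ind_false// mulr0 le_eqVlt; apply/orP; left.
apply/negPn/negP => nz; apply: h.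
apply: rspan_le (Phi_support (b := b) (a := (a + (b + 2)).+1) _ _ nz) => //.
- rewrite /f /span_exponent; apply: leq_mul; first exact: ltnW.
  by rewrite !leq_add2r leq_mul2l /=; move: ham; rewrite /=; nia.
- exact: generic_entries gst.
- move=> q qs; have [h1 h2] := hab _ qs; have [h3 h4] := hq _ qs; split.
    by apply: rspanD => //; apply: rspanZ => //; apply: gens_col h3.
  by apply: rspanD => //; apply: rspanZ => //; apply: gens_row h4.
Qed.

End Walks.

Lemma count_avoid (T : finType) (A X : {set T}) (r : seq T) (k a : nat) :
  uniq r -> (#|T| <= size r + a)%N -> (k + a + #|X| <= #|A|)%N ->
  (k <= count (fun i => (i \in A) && (i \notin X)) r)%N.
Proof.
move=> ur ra kA; rewrite -size_filter -(card_uniqP (filter_uniq _ ur)).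
set F := filter _ r; set C := [set i in r].
have sub : A \subset [set i in F] :|: (X :|: ~: C).
  apply/fintype.subsetP => i iA; rewrite !inE mem_filter iA /=.
  by case: (i \in X); case: (i \in r).
have c1 : #|C| = size r by rewrite cardsE (card_uniqP ur).
have c2 : #|[set i in F]| = #|F| by rewrite cardsE.
have := leq_trans (subset_leq_card sub) (leq_card_setU _ _); rewrite c2.
have := (leq_card_setU X (~: C)).1; have := cardsC C; rewrite c1.
by move: ra kA; lia.
Qed.

Lemma card_bigcup_seq (T : finType) (J : Type) (r : seq J) (F : J -> {set T}) k :
  (forall j, (#|F j| <= k)%N) -> (#|\bigcup_(j <- r) F j| <= size r * k)%N.
Proof.
move=> hF; elim: r => [|j r IH]; first by rewrite big_nil cards0.
by rewrite big_cons mulSn (leq_trans (leq_card_setU _ _))// leq_add.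
Qed.

Lemma notin_bigcup_seq (T : finType) (J : eqType) (r : seq J) (F : J -> {set T}) i j :
  i \notin \bigcup_(j <- r) F j -> j \in r -> i \notin F j.
Proof.
elim: r => // k r IH; rewrite big_cons in_setU negb_or => /andP[h1 /IH h2].
by rewrite inE => /predU1P[->|/h2].
Qed.

(** * Greedy choice of generic pairs *)

Section CommonStructure.
Variables (R : realFieldType) (n e b c d : nat) (B : 'I_n -> 'I_n -> R).
Variables (Grow Gcol : 'I_n -> seq R).
Notation M := (2 ^ e)%N.
Notation LL := (enum 'I_n ++ enum 'I_n).
Notation vecs := (map (@unit_vec n)).
Notation m := (4 * c + 4)%N.
Notation bs := (2 * (2 * span_exponent b 0 m + 4) + 4)%N.
Hypotheses (e4 : (4 <= e)%N) (mM : (2 * m + 3 <= M)%N).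
Hypothesis hrow : forall i, exists E : {set 'I_n}, (#|E| <= M ^ 3)%N /\
  forall j, j \notin E -> rspan M b (Grow i) (B i j).
Hypothesis hcol : forall j, exists E : {set 'I_n}, (#|E| <= M ^ 3)%N /\
  forall i, i \notin E -> rspan M b (Gcol j) (B i j).
Hypotheses (drow : forall i, (size (Grow i) <= d)%N) (dcol : forall i, (size (Gcol i) <= d)%N).
Hypothesis hB : M%:R ^- c <= bpr B LL LL.

Let e0 : (0 < e)%N. Proof. exact: leq_trans e4. Qed.

Let copiesl (st : seq ('I_n * 'I_n)) := flatten [seq nseq M p.1 | p <- st].
Let copiesr (st : seq ('I_n * 'I_n)) := flatten [seq nseq M p.2 | p <- st].

Lemma flatten_nseq_dbl (f : 'I_n * 'I_n -> 'I_n) st :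
  perm_eq (flatten [seq nseq M (f p) | p <- st] ++ flatten [seq nseq M (f p) | p <- st])
    (flatten [seq nseq (M + M) (f p) | p <- st]).
Proof.
elim: st => //= p st /permP IH; apply/permP => q; have := IH q.
by rewrite nseqD !count_cat; lia.
Qed.

Lemma bpr_permX xs xs' ys : perm_eq xs xs' -> bpr B xs ys = bpr B xs' ys.
Proof. by move=> h; rewrite !bprE; exact: apr_perm h. Qed.

Lemma bpr_permY xs ys ys' : perm_eq ys ys' -> bpr B xs ys = bpr B xs ys'.
Proof. by move=> h; exact: apr_perm h. Qed.

Lemma bpr_dropX xs xs' ys : bpr B ((xs ++ xs') ++ (xs ++ xs')) ys <= bpr B (xs' ++ xs') ys.
Proof.
rewrite (bpr_permX ys (_ : perm_eq _ ((xs' ++ xs) ++ (xs' ++ xs)))); last first.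
  by apply/permP => q; rewrite !count_cat; lia.
by rewrite !bprE; exact: apr_drop.
Qed.

Lemma bpr_dropY xs ys ys' : bpr B xs ((ys ++ ys') ++ (ys ++ ys')) <= bpr B xs (ys' ++ ys').
Proof.
rewrite (bpr_permY xs (_ : perm_eq _ ((ys' ++ ys) ++ (ys' ++ ys)))); last first.
  by apply/permP => q; rewrite !count_cat; lia.
exact: apr_drop.
Qed.

(** The exponent (e - 1)/2, rounded down, is at least (e - 2)/2, so [4 * c + 4] factors beat M^c
    once [e >= 4]. *)
Lemma step_prob_small : (step_prob R e) ^+ m < M%:R ^- c.
Proof.
rewrite /step_prob -exprVn -exprM exprVn ltf_pV2 ?posrE ?exprn_gt0 ?ltr0n ?expn_gt0//.
rewrite -!natrX ltr_nat -expnM ltn_exp2l//.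
by have := odd_double_half e.-1; move: e4; nia.
Qed.

Lemma generic_short st rx ry : generic e B b Grow Gcol bs st -> size st = m ->
  bpr B ((rx ++ copiesl st) ++ (rx ++ copiesl st)) ((ry ++ copiesr st) ++ (ry ++ copiesr st))
    < M%:R ^- c.
Proof.
move=> gst sst; apply: le_lt_trans (bpr_dropX _ _ _) _; apply: le_lt_trans (bpr_dropY _ _ _) _.
rewrite (bpr_permX _ (flatten_nseq_dbl _ _)) (bpr_permY _ (flatten_nseq_dbl _ _)).
apply: le_lt_trans step_prob_small; rewrite -sst.
have h := Phi_bound e0 0 (leqnn bs) _ _ gst (absorbed0 e0 Grow Gcol st).
apply: le_trans (h _ _); rewrite ?sst//.
rewrite -PhiE /bpr; apply: Ex_mono => X _; rewrite pr_lin; apply: Ex_mono => Y _.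
have l0 Z : lin (fun=> 0) Z = 0 :> R by rewrite [lin _ _]big1// => i _; rewrite mul0rz.
by rewrite !l0 !addr0 lin_exch.
Qed.

(** Add generic pairs while too many rows escape the span of the current generators. By
    [generic_short] this stops before [m] pairs, and the generators then serve almost all rows. *)
Lemma common_structure : exists Q : seq R, (size Q <= m * (2 * d))%N /\
  exists Bad : {set 'I_n}, (#|Bad| <= M ^ 4)%N /\
  forall i, i \notin Bad -> exists E : {set 'I_n}, (#|E| <= M ^ 4)%N /\
    forall j, j \notin E -> rspan M bs Q (B i j).
Proof.
have /choice[Er hEr] := hrow; have /choice[Ec hEc] := hcol.
pose inv st rx ry := [/\ generic e B b Grow Gcol bs st, uniq rx, uniq ry,
  (n <= size rx + size st * M)%N /\ (n <= size ry + size st * M)%N &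
  M%:R ^- c <= bpr B ((rx ++ copiesl st) ++ (rx ++ copiesl st))
                     ((ry ++ copiesr st) ++ (ry ++ copiesr st))].
suff H N : forall st rx ry, (size st + N = m)%N -> inv st rx ry ->
  exists Q : seq R, (size Q <= m * (2 * d))%N /\
  exists Bad : {set 'I_n}, (#|Bad| <= M ^ 4)%N /\
  forall i, i \notin Bad -> exists E : {set 'I_n}, (#|E| <= M ^ 4)%N /\
    forall j, j \notin E -> rspan M bs Q (B i j).
  apply: (H m [::] (enum 'I_n) (enum 'I_n)) => //; split; rewrite ?enum_uniq//.
    by rewrite size_enum_ord mul0n addn0.
  by rewrite /copiesl /copiesr /= !cats0.
elim: N => [|N IH] st rx ry sst [gst urx ury [nx ny] hb].
  by rewrite addn0 in sst; have := generic_short rx ry gst sst; rewrite ltNge hb.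
pose Q := gens_of Grow Gcol st.
pose S i := [set j | ~~ `[< rspan M bs Q (B i j) >]].
pose Bad := [set i | (M ^ 4 < #|S i|)%N].
have sm : (size st < m)%N by rewrite -sst -addn1 leq_add2l.
(* Room for [M] fresh indices after removing the consumed ones and the exceptional sets of all
   chosen rows or columns. *)
have arith : (M + size st * M + (size st).+1 * M ^ 3 <= M ^ 4)%N.
  have h3 : (M <= M ^ 3)%N by rewrite -{1}(expn1 M) leq_pexp2l// expn_gt0.
  apply: (@leq_trans ((2 * m + 3) * M ^ 3)); last by rewrite (expnS _ 3) leq_mul2r mM orbT.
  have : (size st * M <= m * M ^ 3)%N by rewrite leq_mul// ltnW.
  have : ((size st).+1 * M ^ 3 <= m * M ^ 3)%N by rewrite leq_mul2r sm orbT.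
  move: h3; set x := (M ^ 3)%N; set y := M; nia.
have [small|big] := leqP #|Bad| (M ^ 4).
  exists Q; split.
    apply: (@leq_trans (size st * (2 * d))); last by rewrite leq_mul2r (ltnW sm) orbT.
    rewrite /Q; elim: (st) => //= p st' IHs; rewrite size_cat mulSn leq_add//.
    by rewrite size_cat mul2n -addnn leq_add.
  exists Bad; split=> // i; rewrite inE -leqNgt => hS; exists (S i); split=> // j.
  by rewrite inE negbK => /asboolP.
(* The row is chosen first, outside the exceptional sets of the old columns. *)
have [i [rx' [iP urx' srx' hbx]]] : exists i rx', [/\ (i \in Bad) &&
    (i \notin \bigcup_(q <- st) Ec q.2), uniq rx', size rx = (M + size rx')%N &
    bpr B ((rx ++ copiesl st) ++ (rx ++ copiesl st)) ((ry ++ copiesr st) ++ (ry ++ copiesr st)) <=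
    bpr B ((rx' ++ (nseq M i ++ copiesl st)) ++ (rx' ++ (nseq M i ++ copiesl st)))
       ((ry ++ copiesr st) ++ (ry ++ copiesr st))].
  rewrite /=.
  have cnt : (M <= count (fun i => (i \in Bad) && (i \notin \bigcup_(q <- st) Ec q.2)) rx)%N.
    apply: (@count_avoid _ _ _ _ _ (size st * M)) => //; first by rewrite card_ord.
    have hX := @card_bigcup_seq _ _ st (fun q => Ec q.2) (M ^ 3) (fun q => (hEc q.2).1).
    apply: leq_trans (ltnW big); apply: leq_trans arith; rewrite leq_add2l.
    by apply: leq_trans hX _; rewrite leq_mul2r leqnSn orbT.
  have [i [rx' [h1 h2 h3 h4]]] := @apr_select R _ R _
     (vecs ((ry ++ copiesr st) ++ (ry ++ copiesr st))) (fun Y i => lin (B i) Y)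
     e _ _ (copiesl st) urx cnt.
  by exists i, rx'; split=> //; rewrite !bprE; exact: h4.
have /andP[iBad iEc] := iP.
(* The column then comes from the entries of row [i] that escape the span, outside the exceptional
   sets of row [i] and the old rows. *)
have [j [ry' [jP ury' sry' hby]]] : exists j ry', [/\ (j \in S i) &&
    (j \notin \bigcup_(k <- i :: map fst st) Er k), uniq ry', size ry = (M + size ry')%N &
    bpr B ((rx' ++ (nseq M i ++ copiesl st)) ++ (rx' ++ (nseq M i ++ copiesl st)))
       ((ry ++ copiesr st) ++ (ry ++ copiesr st)) <=
    bpr B ((rx' ++ (nseq M i ++ copiesl st)) ++ (rx' ++ (nseq M i ++ copiesl st)))
       ((ry' ++ (nseq M j ++ copiesr st)) ++ (ry' ++ (nseq M j ++ copiesr st)))].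
  have cnt : (M <= count (fun j => (j \in S i) && (j \notin \bigcup_(k <- i :: map fst st) Er k)) ry)%N.
    apply: (@count_avoid _ _ _ _ _ (size st * M)) => //; first by rewrite card_ord.
    have := @card_bigcup_seq _ _ (i :: map fst st) Er (M ^ 3) (fun k => (hEr k).1).
    rewrite /= size_map => hX; move: iBad; rewrite inE => big'.
    by apply: leq_trans (ltnW big'); apply: leq_trans arith; rewrite leq_add2l.
  have [j [ry' [h1 h2 h3 h4]]] := @apr_select R _ R _
     (vecs ((rx' ++ (nseq M i ++ copiesl st)) ++ (rx' ++ (nseq M i ++ copiesl st))))
     (fun X j => lin (B^~ j) X) e _ _ (copiesr st) ury cnt.
  by exists j, ry'; split.
have /andP[jS jEr] := jP.
apply: (IH ((i, j) :: st) rx' ry'); first by rewrite /= addSn -addnS.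
split=> //.
- split=> //=.
  + by move: jS; rewrite inE => /asboolP.
  + by apply: (hEr i).2; apply: notin_bigcup_seq jEr _; rewrite mem_head.
  + move=> q qst; split.
      by apply: (hEc q.2).2; apply: (notin_bigcup_seq iEc qst).
    apply: (hEr q.1).2; apply: notin_bigcup_seq jEr _.
    by rewrite inE map_f ?orbT.
- by split; rewrite [size (_ :: _)]/= mulSn addnCA addnA -?srx' -?sry'.
- exact: le_trans hb (le_trans hbx hby).
Qed.

End CommonStructure.

Lemma comb_sum (V : zmodType) (J : Type) (h : nat) (r : seq J) (f : J -> V) (p : J -> int) :
  (forall x, (`|p x| <= h)%N) -> comb h (map f r) (\sum_(x <- r) f x *~ p x).
Proof.
move=> ph; elim: r => [|x r IH]; first by rewrite big_nil.
by rewrite big_cons /=; exists (p x); split=> //; rewrite addrAC subrr add0r.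
Qed.

Lemma rspan_comb (R : realFieldType) M h b (G : seq R) (v : R) D :
  (1 < M)%N -> (0 < D <= M ^ b)%N -> (h <= M ^ b)%N -> comb h G (v *+ D) -> rspan M b G v.
Proof.
move=> M1 /andP[D0 Db] hb hv; exists D%:Z; split.
- by rewrite eqz_nat -lt0n.
- by rewrite absz_nat.
- exact: comb_le hb hv.
Qed.

(** * Combining the row and column operations *)

Section Assembly.
Variables (R : realFieldType) (c w : nat).
Notation LL := (fun n => enum 'I_n ++ enum 'I_n).

(** [c1] and [c2] are the concentration exponents after the row and then the column operation; [b]
    and [d] bound the exponents and numbers of generators of single rows and columns. *)
Let c1 := row_exponent c w.
Let c2 := row_exponent c1 w.
Let b := (4 * c1 + 6 * c2 + 10)%N.
Let d := (2 * c2 + 4 * c1 + 2)%N.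
Let m := (4 * c2 + 4)%N.
Let bs := (2 * (2 * span_exponent b 0 m + 4) + 4)%N.

Definition structure_exponent : nat := (bs + c1 + c2 + 1)%N.
Definition structure_size : nat :=
  (m * (2 * d) + (2 * c.+1) * (2 * c1.+1) + 2 * c.+1 + 2 * c1.+1)%N.
Definition structure_threshold : nat := (2 * m + 3 + c1 + 2 * c2 + 4 * c1 + 4)%N.

Lemma bilinear_structure (n e : nat) (A : 'I_n -> 'I_n -> R) :
  (structure_threshold <= e)%N -> (0 < n)%N -> (n <= (2 ^ e) ^ w)%N ->
  (2 ^ e)%:R ^- c <= bpr A (LL n) (LL n) ->
  exists (I0 J0 I J : {set 'I_n}) (k l : nat) (kk ll : 'I_n -> 'I_n -> int) (g : seq R),
  [/\ (#|I0| <= structure_size)%N /\ (#|J0| <= structure_size)%N,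
      (#|~: I| <= (2 ^ e) ^ 5)%N /\ (#|~: J| <= (2 ^ e) ^ 5)%N &
      [disjoint I & I0] /\ [disjoint J & J0]] /\
  [/\ (0 < k <= (2 ^ e) ^ structure_exponent)%N,
      (0 < l <= (2 ^ e) ^ structure_exponent)%N,
      forall i i0, (`|kk i i0| <= (2 ^ e) ^ structure_exponent)%N &
      forall j0 j, (`|ll j0 j| <= (2 ^ e) ^ structure_exponent)%N] /\
  ((size g <= structure_size)%N /\
   forall i, i \in I -> exists E : {set 'I_n}, (#|E| <= (2 ^ e) ^ 5)%N /\
     forall j, j \in J -> j \notin E -> rspan (2 ^ e) structure_exponent g
       (A i j *+ (k * l) + (\sum_(i0 in I0) A i0 j *~ kk i i0) *+ l +
        (\sum_(j0 in J0) A i j0 *~ ll j0 j) *+ k)).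
Proof.
set M := (2 ^ e)%N => et n0 nM hA.
have eM : (e < M)%N by rewrite ltn_expl.
have e0 : (0 < e)%N by apply: leq_trans et; rewrite /structure_threshold; clear; lia.
have M1 : (1 < M)%N by rewrite -{1}(expn0 2) ltn_exp2l.
have wk x y : (x <= y)%N -> (M ^ x <= M ^ y)%N.
  by move=> xy; apply: leq_pexp2l => //; rewrite expn_gt0.
have ltM x : (x <= structure_threshold)%N -> (x <= M)%N.
  by move=> xt; apply: leq_trans (ltnW eM); apply: leq_trans et.
have mulM x y : (x <= structure_threshold)%N -> (x * M ^ y <= M ^ y.+1)%N.
  by move=> xt; rewrite expnS leq_mul2r ltM ?orbT.
have [I0 [I [k [kk [Q [[cI0 cI dI /andP[k0 kM] hkk] [QI QnI hQ hbQ]]]]]]] :=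
  row_operation e0 n0 nM hA.
rewrite -/c1 in cI kM hkk hQ hbQ.
(* The column operation is the row operation on the transpose. *)
have hbQ' : M%:R ^- c1 <= bpr (fun i j => Q j i) (LL n) (LL n) by rewrite bpr_tr.
have [J0 [J [l [ll [B' [[cJ0 cJ dJ /andP[l0 lM] hll] [BJ BnJ hB hbB]]]]]]] :=
  row_operation e0 n0 nM hbQ'.
rewrite -/c2 in cJ lM hll hB hbB.
pose B i j := B' j i.
have hbB' : M%:R ^- c2 <= bpr B (LL n) (LL n) by rewrite (bpr_tr B').
have /choice[gc hgc] : forall j, exists g : seq 'I_n, (size g <= 2 * c2)%N /\
    exists E : {set 'I_n}, (#|E| <= M ^ 3)%N /\
    forall i, i \notin E -> rspan M b (map (B' j) g) (B i j).
  move=> j; have [g [D [E [sg DM cE hE]]]] := inverse_littlewood_offord e0 (hB j).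
  exists g; split=> //; exists E; split.
    apply: leq_trans cE _; apply: mulM; rewrite /structure_threshold; clear; lia.
  move=> i /hE h; apply: rspan_comb h => //.
    by have /andP[-> h2] := DM; rewrite (leq_trans h2)// wk// /b; clear; lia.
  by rewrite wk// /b; clear; lia.
(* Row structure is known for [Q]; entries of [B] also involve the columns in [J0], whose entries in
   row [i] are added as generators. *)
have /choice[gr hgr] : forall i, exists g : seq 'I_n, (size g <= 2 * c1)%N /\
    exists E : {set 'I_n}, (#|E| <= M ^ 3)%N /\
    forall j, j \notin E -> rspan M b (map (Q i) g ++ map (Q i) (enum J0)) (B i j).
  move=> i; have [g [D [E [sg DM cE hE]]]] := inverse_littlewood_offord e0 (hQ i).
  exists g; split=> //; exists E; split.
    apply: leq_trans cE _; apply: mulM; rewrite /structure_threshold; clear; lia.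
  move=> j /hE h.
  have [jJ|jJ] := boolP (j \in J); last by rewrite /B BnJ//; apply: rspan0.
  rewrite /B BJ//.
  have h1 : rspan M (4 * c1).+1 (map (Q i) g) (Q i j).
    apply: rspan_comb h => //.
    by have /andP[-> h2] := DM; rewrite (leq_trans h2)// wk//; clear; lia.
  have h2 : rspan M c2 (map (Q i) (enum J0)) (\sum_(j0 in J0) Q i j0 *~ ll j j0).
    apply: (@rspan_comb _ _ (M ^ c2) _ _ _ 1) => //; first by rewrite expn_gt0 (ltnW M1).
    by rewrite mulr1n -big_enum; apply: comb_sum.
  have h3 := rspanD M1 (rspan_catl (map (Q i) (enum J0)) (rspanZ M1 (z := l%:Z) lM h1))
    (rspan_catr (map (Q i) g) h2).
  by apply: rspan_le h3 => //; rewrite /b; clear; lia.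
have szr i : (size (map (Q i) (gr i) ++ map (Q i) (enum J0)) <= d)%N.
  rewrite size_cat !size_map -cardE; have [h _] := hgr i.
  by apply: leq_trans (leq_add h cJ0) _; rewrite /d; clear; lia.
have szc j : (size (map (B' j) (gc j)) <= d)%N.
  by rewrite size_map; have [h _] := hgc j; apply: leq_trans h _; rewrite /d; clear; lia.
have [] := @common_structure R n e b c2 d B _ _ _ _ (fun i => (hgr i).2) (fun j => (hgc j).2)
  szr szc hbB'.
- by apply: leq_trans et; rewrite /structure_threshold; clear; lia.
- by apply: ltM; rewrite /structure_threshold /m; clear; lia.
move=> G [sG [Bad [cBad hBad]]].
(* Composing the two operations creates a double sum over [I0] and [J0] absent from the required
   formula; its entries do not depend on [i] or [j] and join the generators. *)
pose pairs := [seq (i0, j0) | i0 <- enum I0, j0 <- enum J0].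
exists I0, J0, (I :\: Bad), J, k, l, kk, (fun j0 j => ll j j0),
  (G ++ map (fun p => A p.1 p.2) pairs).
have eb1 : (c1 <= structure_exponent)%N by rewrite /structure_exponent; clear; lia.
have eb2 : (c2 <= structure_exponent)%N by rewrite /structure_exponent; clear; lia.
have cM5 x : (x <= structure_threshold)%N -> (x * M ^ 2 + M ^ 4 <= M ^ 5)%N.
  move=> xt; apply: (@leq_trans (M ^ 4 + M ^ 4)).
    by rewrite leq_add2r (leq_trans (mulM _ _ xt))// wk.
  by rewrite addnn -mul2n (expnS _ 4) leq_mul2r M1 orbT.
split; last split; first split.
- by rewrite /structure_size; split; move: cI0 cJ0; clear; lia.
- split.
    rewrite setCD; apply: leq_trans (leq_card_setU _ _).1 _.
    apply: leq_trans (leq_add cI cBad) (cM5 _ _).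
    by rewrite /structure_threshold; clear; lia.
  apply: leq_trans cJ (leq_trans (leq_addr _ _) (cM5 _ _)).
  by rewrite /structure_threshold; clear; lia.
- by split=> //; apply: disjointWl dI; apply: subsetDl.
- split.
  + by rewrite k0 (leq_trans kM)// wk.
  + by rewrite l0 (leq_trans lM)// wk.
  + by move=> i i0; rewrite (leq_trans (hkk i i0))// wk.
  + by move=> j0 j; rewrite (leq_trans (hll j j0))// wk.
split.
  rewrite size_cat size_map size_allpairs -!cardE /structure_size -!addnA.
  by rewrite leq_add// (leq_trans (leq_mul cI0 cJ0))// leq_addr.
move=> i; rewrite inE => /andP[iBad iI].
have [E [cE hE]] := hBad i iBad.
exists E; split; first by rewrite (leq_trans cE)// wk.
move=> j jJ jE.
have h1 := rspan_catl (map (fun p => A p.1 p.2) pairs) (hE j jE).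
pose S := \sum_(p <- pairs) A p.1 p.2 *~ (kk i p.1 * ll j p.2).
have h2 : rspan M (c1 + c2) (map (fun p => A p.1 p.2) pairs) S.
  apply: (@rspan_comb _ _ (M ^ (c1 + c2)) _ _ _ 1) => //; first by rewrite expn_gt0 (ltnW M1).
  rewrite mulr1n /S; apply: (@comb_sum _ _ _ pairs (fun p => A p.1 p.2) (fun p => kk i p.1 * ll j p.2)).
  by move=> p; rewrite abszM expnD leq_mul.
have h3 := rspanD M1 h1 (rspanN M1 (rspan_catr G h2)).
have e1 : B i j - S = A i j *+ (k * l) + (\sum_(i0 in I0) A i0 j *~ kk i i0) *+ l +
        (\sum_(j0 in J0) A i j0 *~ ll j j0) *+ k.
  rewrite /B BJ// QI// mulrnDl -mulrnA -addrA -[RHS]addrA -addrA; congr (_ + (_ + _)).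
  under eq_bigr => j0 _ do rewrite QI// mulrzDl.
  rewrite big_split /= -addrA [X in _ + X](_ : _ = 0) ?addr0.
    by rewrite -sumrMnl; apply: eq_bigr => j0 _; rewrite !pmulrn mulrzAC.
  apply/eqP; rewrite subr_eq0 /S big_allpairs /= exchange_big /= big_enum.
  apply/eqP; apply: eq_bigr => j0 _; rewrite big_enum mulrz_suml.
  by apply: eq_bigr => i0 _; rewrite mulrzA.
rewrite -e1; apply: rspan_le h3 => //.
have -> : structure_exponent = (bs + (c1 + c2)).+1 by rewrite /structure_exponent; clear; lia.
exact: leqnn.
Qed.

End Assembly.

End Combinatorics.

(** * From random variables to signed sums *)

Lemma size_ssum (V : zmodType) (s : seq V) : size (ssum s) = (2 ^ size s)%N.
Proof. by elim: s => //= w s IH; rewrite size_cat !size_map IH expnS mul2n addnn. Qed.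

Section SignVectors.
Variables (R : realFieldType) (n : nat).
Notation vecs := (map (@unit_vec n)).

Definition sign_vec (eps : {ffun 'I_n -> bool}) : {ffun 'I_n -> int} :=
  [ffun i => if eps i then 1 else -1].

Lemma sign_vec_ssum eps : sign_vec eps \in ssum (vecs (enum 'I_n)).
Proof.
have -> : sign_vec eps = \sum_(i <- enum 'I_n) (if eps i then unit_vec i else - unit_vec i).
  apply/ffunP => j; rewrite big_enum /= sum_ffunE ffunE (bigD1 j)//= big1 => [|i ij].
    by case: ifP => _; rewrite !ffunE eqxx addr0.
  by case: ifP => _; rewrite !ffunE eq_sym (negbTE ij) ?oppr0.
elim: (enum 'I_n) => [|i r IH]; first by rewrite big_nil inE.
rewrite big_cons /= mem_cat; apply/orP; case: (eps i); [left|right]; apply/mapP;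
  by eexists; [exact: IH|rewrite addrC].
Qed.

(** The sign vectors are 2^n distinct members of a list of length 2^n, so they enumerate it. *)
Lemma Ex_sign_vec (f : {ffun 'I_n -> int} -> R) :
  Ex (vecs (enum 'I_n)) f = (\sum_eps f (sign_vec eps)) / 2 ^+ n.
Proof.
rewrite /Ex size_map size_enum_ord; congr (_ / _).
pose s := [seq sign_vec eps | eps <- enum {ffun 'I_n -> bool}].
have us : uniq s.
  rewrite map_inj_uniq ?enum_uniq// => eps del /ffunP h; apply/ffunP => i.
  by have := h i; rewrite !ffunE; case: (eps i); case: (del i).
have sub : {subset s <= ssum (vecs (enum 'I_n))}.
  by move=> v /mapP[eps _ ->]; exact: sign_vec_ssum.
have szs : (size (ssum (vecs (enum 'I_n))) <= size s)%N.
  by rewrite size_ssum (size_map (@unit_vec n)) size_enum_ord /s size_map -cardE card_ffun card_bool card_ord.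
have [_ eqs] := uniq_min_size us sub szs.
have pe : perm_eq (ssum (vecs (enum 'I_n))) s.
  apply: uniq_perm => [||v]; [exact: leq_size_uniq us sub szs|exact: us|].
  by rewrite eqs.
by rewrite (perm_big _ pe) /= big_map big_enum.
Qed.

Lemma lin_sign_vec (A : 'I_n -> 'I_n -> R) (eps del : {ffun 'I_n -> bool}) :
  lin (fun i => lin (A i) (sign_vec del)) (sign_vec eps) =
  \sum_i \sum_j A i j * (if eps i then 1 else -1) * (if del j then 1 else -1).
Proof.
rewrite /lin; apply: eq_bigr => i _; rewrite mulrz_suml; apply: eq_bigr => j _.
by rewrite !ffunE; case: (eps i); case: (del j); rewrite ?mulrNz ?mulr1z ?mulr1 ?mulrN1 ?mulNrz.
Qed.

(** One squaring doubles the variables [Y], a second doubles [X] and moves the target to 0. *)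
Lemma bpr_symmetrize (A : 'I_n -> 'I_n -> R) a :
  Ex (vecs (enum 'I_n)) (fun X => Ex (vecs (enum 'I_n)) (fun Y =>
    (lin (fun i => lin (A i) Y) X == a)%:R)) ^+ 4 <=
  bpr A (enum 'I_n ++ enum 'I_n) (enum 'I_n ++ enum 'I_n).
Proof.
have jensen (V : zmodType) (s : seq V) (f g : V -> R) : (forall v, 0 <= f v) ->
    (forall v, f v ^+ 2 <= g v) -> Ex s f ^+ 2 <= Ex s g.
  move=> f0 fg; rewrite -[leRHS]mulr1 -[X in _ * X](Ex_cst s); apply: Ex_CS => // v.
    exact: le_trans (sqr_ge0 _) (fg v).
  by rewrite mulr1.
rewrite (_ : 4 = 2 * 2)%N// exprM.
apply: (@le_trans _ _ (bpr A (enum 'I_n) (enum 'I_n ++ enum 'I_n) ^+ 2)).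
  rewrite ler_pXn2r ?nnegrE ?sqr_ge0//; last by apply: Ex_ge0 => X; apply: pr_ge0.
  apply: jensen => X; first by apply: Ex_ge0 => Y; rewrite ler0n.
  under eq_Ex => Y do rewrite -lin_exch.
  by rewrite -pr_lin map_cat; apply: pr_sqr.
rewrite !bprE; apply: jensen => Y; first exact: pr_ge0.
by rewrite map_cat; apply: pr_sqr.
Qed.

End SignVectors.

Lemma measure_big_disjoint (R : realType) (d : measure_display) (T : measurableType d)
    (P : probability T R) (U : choiceType) (s : seq U) (F : U -> set T) :
  uniq s -> (forall u, measurable (F u)) ->
  (forall u v w, F u w -> F v w -> u = v) ->
  P (\big[setU/set0]_(u <- s) F u)%classic = (\sum_(u <- s) P (F u))%E.
Proof.
move=> us mF dF; elim: s us => [|u s IH]; first by rewrite !big_nil measure0.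
rewrite cons_uniq => /andP[us /IH IHs]; rewrite !big_cons -IHs.
have mB : measurable (\big[setU/set0]_(v <- s) F v)%classic by apply: bigsetU_measurable.
apply: measureU => //.
apply/seteqP; split => // w [Fu]; rewrite -bigcup_seq => -[v /= vs Fv].
by move: us; rewrite (dF _ _ _ Fu Fv) vs.
Qed.

(** By independence every sign pattern has probability 2^(-2n). These cells have total mass 1, so
    outcomes where some variable is not a sign are negligible. *)
Lemma bernoulli_pair_prob (R : realType) (d : measure_display) (T : measurableType d)
    (P : probability T R) (n : nat) (x y : 'I_n -> {RV P >-> R}) (A : 'M[R]_n) (a : R) :
  independent_bernoulli_pair x y ->
  (P [set w | (\sum_i \sum_j A i j * x i w * y j w = a)%R]%classic <=
  (Ex (map (@unit_vec n) (enum 'I_n)) (fun X => Ex (map (@unit_vec n) (enum 'I_n)) (fun Y =>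
    (lin (fun i => lin (A i) Y) X == a)%:R)))%:E)%E.
Proof.
move=> [hx hy ind].
pose U : finType := ({ffun 'I_n -> bool} * {ffun 'I_n -> bool})%type.
pose sg (b : bool) : R := if b then 1 else -1.
pose val (u : U) (k : 'I_n + 'I_n) : R :=
  match k with inl i => sg (u.1 i) | inr j => sg (u.2 j) end.
pose Z (k : 'I_n + 'I_n) : {RV P >-> R} := match k with inl i => x i | inr j => y j end.
pose cell (u : U) : set T := [set w | forall k, Z k w = val u k]%classic.
have n1 : (1 : R) = -1 -> False by move=> h; lra.
have sgI : injective sg by move=> [] [] // h; exfalso; apply: n1; rewrite -?h.
have cellE u : cell u = (\bigcap_(k in [set` [set: 'I_n + 'I_n]%SET]) (Z k @^-1` [set val u k]))%classic.
  apply/seteqP; split => w h k; first by move=> _; apply: h.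
  by apply: h => /=; rewrite inE.
have mcell u : measurable (cell u).
  rewrite cellE; apply: fin_bigcap_measurable; first exact: finite_finset.
  move=> k _; have mZ : measurable_fun [set: T]%classic (Z k) by apply: measurable_funP.
  by rewrite -[X in measurable X]setTI; apply: mZ => //; apply: measurable_set1.
have Pcell u : P (cell u) = (2^-1 ^+ (n + n))%:E.
  rewrite cellE ind => [|k _]; last exact: measurable_set1.
  have Pk k : P (Z k @^-1` [set val u k])%classic = (2^-1)%:E.
    case: k => [i|j] /=; rewrite /sg; case: ifP => _.
    - by have [] := hx i.
    - by have [] := hx i.
    - by have [] := hy j.
    - by have [] := hy j.
  under eq_bigr => k _ do rewrite Pk.
  rewrite prodEFin; congr EFin.
  by rewrite prodr_const cardsT card_sum card_ord.
have dcell u v w : cell u w -> cell v w -> u = v.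
  move=> hu hv; case: u v hu hv => [u1 u2] [v1 v2] hu hv; congr pair; apply/ffunP => i; apply: sgI.
    by have := hv (inl i); rewrite (hu (inl i)).
  by have := hv (inr i); rewrite (hu (inr i)).
have cU : #|U| = (2 ^ (n + n))%N by rewrite card_prod !card_ffun card_bool card_ord expnD.
pose W := (\big[setU/set0]_(u <- enum U) cell u)%classic.
have PW : P W = 1%E.
  rewrite measure_big_disjoint ?enum_uniq//.
  under eq_bigr => u _ do rewrite Pcell.
  rewrite sumEFin; congr EFin; rewrite big_enum sumr_const cU -[LHS]mulr_natl natrX -exprMn divff ?expr1n//.
pose ev (u : U) := \sum_i \sum_j A i j * sg (u.1 i) * sg (u.2 j) == a.
pose V := (\big[setU/set0]_(u <- [seq u <- enum U | ev u]) cell u)%classic.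
have mW : measurable W by apply: bigsetU_measurable.
have mV : measurable V by apply: bigsetU_measurable.
have PV : P V = ((\sum_(u : U) (ev u)%:R) / 2 ^+ (n + n))%:E.
  rewrite measure_big_disjoint//; last by apply: filter_uniq; apply: enum_uniq.
  under eq_bigr => u _ do rewrite Pcell.
  rewrite sumEFin; congr EFin; rewrite big_filter big_enum_cond -exprVn mulr_suml.
  rewrite big_mkcond; apply: eq_bigr => u _ /=.
  by case: (ev u); rewrite ?mul1r ?mul0r.
apply: (@le_trans _ _ (P V)); last first.
  rewrite PV lee_fin le_eqVlt; apply/orP; left; apply/eqP/esym.
  rewrite Ex_sign_vec; under eq_bigr => eps _ do rewrite Ex_sign_vec.
  rewrite -mulr_suml pair_big /= exprD invfM mulrA; congr (_ / _ / _).
  by apply: eq_bigr => -[eps del] _; rewrite lin_sign_vec.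
set S := [set w | _]%classic.
have mS : measurable S.
  have -> : S = ([set: T] `&` (fun w => \sum_i \sum_j A i j * x i w * y j w) @^-1` [set a])%classic.
    by rewrite setTI.
  suff mf : measurable_fun [set: T]%classic (fun w => \sum_i \sum_j A i j * x i w * y j w).
    by apply: mf => //; apply: measurable_set1.
  apply: measurable_sum => i; apply: measurable_sum => j.
  apply: measurable_realfun.measurable_funM; last exact: measurable_funP.
  by apply: measurable_realfun.measurable_funM; [exact: measurable_cst|exact: measurable_funP].
have sub : (S `<=` V `|` ~` W)%classic.
  move=> w Sw; have [Ww|nW] := pselect (W w); last by right.
  left; move: Ww; rewrite /W /V -!bigcup_seq => -[u /= _ cu]; exists u => //=.
  rewrite mem_filter mem_enum andbT /ev -Sw; apply/eqP.
  apply: eq_bigr => i _; apply: eq_bigr => j _.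
  by have /= -> := cu (inl i); have /= -> := cu (inr j).
have PWc : P (~` W)%classic = 0%E by rewrite probability_setC// PW subee.
rewrite -[leRHS]adde0 -PWc.
apply: (@le_trans _ _ (P (V `|` ~` W)%classic)).
  by apply: le_measure => //; rewrite inE//; apply: measurableU => //; apply: measurableC.
by apply: measureU2 => //; apply: measurableC.
Qed.

(** * Choice of scale and deduction of the theorem *)

Lemma rspan_rational (R : realType) M b (G : seq R) (v H : R) :
  (M ^ b)%:R <= H -> rspan M b G v ->
  bounded_rational_combinations H (fun h : 'I_(size G) => G`_h) v.
Proof.
move=> MH [q [q0 qb /combP[p [ph e]]]].
have int_le (z : int) : (`|z| <= M ^ b)%N -> `|z%:~R| <= H :> R.
  by move=> zb; apply: le_trans MH; rewrite -intr_norm -abszE -pmulrn ler_nat.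
exists (fun h => p h), (fun=> q); split; first by move=> h; split=> //; apply: int_le.
have qR : q%:~R != 0 :> R by rewrite intr_eq0.
apply: (mulIf qR); rewrite mulrzr e mulr_suml; apply: eq_bigr => h _.
by rewrite -[LHS]mulrzr [RHS]mulrAC divfK// mulrC.
Qed.

(* For bounded [n] all the entries of [A] can serve as generators. *)
Lemma trivial_structure (R : realType) (n : nat) (A : 'M[R]_n) (eps B : R) :
  (0 < n)%N -> (n * n)%:R <= B ->
  exists (I0 J0 I J : {set 'I_n}) (k l : int) (kk ll : 'I_n -> 'I_n -> int)
    (s : nat) (g : 'I_s -> R) (A' : 'M[R]_n),
    [/\ (#|I0|%:R <= B /\ #|J0|%:R <= B),
        (n%:R - 1 * n%:R `^ eps <= #|I|%:R /\
         n%:R - 1 * n%:R `^ eps <= #|J|%:R) &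
        ([disjoint I & I0] /\ [disjoint J & J0])] /\
    [/\ (k != 0 /\ l != 0),
        (`|k%:~R| <= n%:R `^ B /\ `|l%:~R| <= n%:R `^ B),
        (forall i i0, i \in I -> i0 \in I0 -> `|(kk i i0)%:~R| <= n%:R `^ B) &
        (forall j0 j, j0 \in J0 -> j \in J -> `|(ll j0 j)%:~R| <= n%:R `^ B)] /\
    [/\ s%:R <= B,
        (forall i j, i \in I -> j \in J ->
           A i j = A' i j / (k%:~R * l%:~R)
                   - (\sum_(i0 in I0) (kk i i0)%:~R * A i0 j) / k%:~R
                   - (\sum_(j0 in J0) (ll j0 j)%:~R * A i j0) / l%:~R) &
        (forall i, i \in I ->
           #|[pred j in J |
                A' i j \notin bounded_rational_combinations (n%:R `^ B) g]|%:R
           <= 1 * n%:R `^ eps)].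
Proof.
move=> n0 nB; have B0 : 0 <= B by apply: le_trans nB; rewrite ler0n.
have p1 : 1 <= n%:R `^ B by rewrite -[leLHS](powRr0 n%:R) ler_powR// ler1n.
exists finset.set0, finset.set0, [set: 'I_n]%SET, [set: 'I_n]%SET, 1, 1, (fun _ _ => 0), (fun _ _ => 0).
exists (n * n)%N, (fun h => mxvec A 0 h), A; split; last split; split=> //.
- by rewrite !cards0.
- by rewrite cardsT card_ord lerBlDr lerDl mul1r powR_ge0.
- by split; rewrite disjoint_sym finset.disjoints_subset finset.sub0set.
- by rewrite normr1.
- by move=> i i0 _; rewrite finset.inE.
- by move=> j0 j; rewrite finset.inE.
- by move=> i j _ _; rewrite !big_set0 !mul0r !subr0 mulr1 divr1.
move=> i _; rewrite (@eq_card0 _ _) ?mul1r ?powR_ge0// => j.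
apply/negP => /andP[_ /negP]; apply; apply: mem_set.
exists (fun h => (h == mxvec_index i j)%:Z), (fun=> 1); split.
  by move=> h; rewrite normr1; split=> //; case: eqP; rewrite ?normr1 ?normr0// (le_trans ler01).
rewrite (bigD1 (mxvec_index i j))//= eqxx divr1 mul1r mxvecE big1 ?addr0// => h /negbTE ->.
by rewrite !mul0r.
Qed.

(** The least [e] with [n <= (2 ^ e) ^ w]; minimality keeps [2 ^ e] within a factor 2 of the w-th
    root of [n]. *)
Lemma nat_scale (w n e0 : nat) : (0 < w)%N -> (2 ^ (e0 * w) < n)%N ->
  exists e, [/\ (e0 < e)%N, (n <= (2 ^ e) ^ w)%N & (2 ^ (e.-1 * w) < n)%N].
Proof.
move=> w0 nbig; have ex : exists e, (n <= (2 ^ e) ^ w)%N.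
  exists n; rewrite -expnM; apply: leq_trans (ltnW (ltn_expl n (ltnSn 1))) _.
  by apply: leq_pexp2l => //; rewrite leq_pmulr.
case: (ex_minnP ex) => e en emin.
have e0e : (e0 < e)%N.
  rewrite ltnNge; apply/negP => ee0; have : (n <= 2 ^ (e0 * w))%N.
    by apply: leq_trans en _; rewrite -expnM; apply: leq_pexp2l => //; rewrite leq_mul2r ee0 orbT.
  by rewrite leqNgt nbig.
exists e; split=> //; rewrite ltnNge; apply/negP => h.
have : (e <= e.-1)%N by apply: emin; rewrite -expnM.
by case: e e0e {en emin h} => // e _ /=; rewrite ltnn.
Qed.

(** Halving [p] yields a point of probability above [p / 2] without assuming that the supremum is
    attained. *)
Lemma rho_b_bpr (R : realType) (d : measure_display) (T : measurableType d)
    (P : probability T R) (n : nat) (x y : 'I_n -> {RV P >-> R}) (A : 'M[R]_n) (p : R) :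
  independent_bernoulli_pair x y -> 0 < p -> (p%:E <= rho_b x y A)%E ->
  (p / 2) ^+ 4 <= bpr A (enum 'I_n ++ enum 'I_n) (enum 'I_n ++ enum 'I_n).
Proof.
move=> hxy p0 hp.
have [a ha] : exists a : R, ((p / 2)%:E <
    P [set w | (\sum_i \sum_j A i j * x i w * y j w = a)%R]%classic)%E.
  apply: contrapT => none.
  suff : (rho_b x y A <= (p / 2)%:E)%E.
    by move=> /(le_trans hp); rewrite lee_fin; lra.
  apply: ge_ereal_sup => z /= [a _ <-]; rewrite leNgt; apply/negP => h.
  by apply: none; exists a.
have := le_trans (ltW ha) (bernoulli_pair_prob A a hxy); rewrite lee_fin => h.
apply: le_trans (bpr_symmetrize A a).
have p2 : 0 <= p / 2 by rewrite ltW// divr_gt0.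
by rewrite ler_pXn2r// nnegrE// (le_trans p2).
Qed.

(* K is the constant of O_C(n^eps); B is the constant of O_{C,eps}(1), also
   used as exponent in n^{O_{C,eps}(1)}. *)
Theorem theorem4p9 (R : realType) (C : R) (hC : 0 < C) :
  exists K : R, forall eps : R, 0 < eps < 1 ->
  exists B : R, forall n : nat, (0 < n)%N ->
  forall (d : measure_display) (T : measurableType d) (P : probability T R)
    (x y : 'I_n -> {RV P >-> R}) (A : 'M[R]_n),
  independent_bernoulli_pair x y ->
  ((n%:R `^ (- C))%:E <= rho_b x y A)%E ->
  exists (I0 J0 I J : {set 'I_n}) (k l : int) (kk ll : 'I_n -> 'I_n -> int)
    (s : nat) (g : 'I_s -> R) (A' : 'M[R]_n),
    [/\ (#|I0|%:R <= B /\ #|J0|%:R <= B),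
        (n%:R - K * n%:R `^ eps <= #|I|%:R /\
         n%:R - K * n%:R `^ eps <= #|J|%:R) &
        ([disjoint I & I0] /\ [disjoint J & J0])] /\
    [/\ (k != 0 /\ l != 0),
        (`|k%:~R| <= n%:R `^ B /\ `|l%:~R| <= n%:R `^ B),
        (forall i i0, i \in I -> i0 \in I0 -> `|(kk i i0)%:~R| <= n%:R `^ B) &
        (forall j0 j, j0 \in J0 -> j \in J -> `|(ll j0 j)%:~R| <= n%:R `^ B)] /\
    [/\ s%:R <= B,
        (forall i j, i \in I -> j \in J ->
           A i j = A' i j / (k%:~R * l%:~R)
                   - (\sum_(i0 in I0) (kk i i0)%:~R * A i0 j) / k%:~R
                   - (\sum_(j0 in J0) (ll j0 j)%:~R * A i j0) / l%:~R) &
        (forall i, i \in I ->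
           #|[pred j in J |
                A' i j \notin bounded_rational_combinations (n%:R `^ B) g]|%:R
           <= K * n%:R `^ eps)].
Proof.
pose C0 := Num.bound C.
have CC0 : C <= C0%:R by apply: ltW; apply: archi_boundP; apply: ltW.
exists 1 => eps /andP[eps0 _].
(* Exceptional sets have size at most M^5 <= 2^(10(e-1)), since [e >= 2], and [w * eps >= 10] turns
   this into at most n^eps; hence the constant 1. *)
pose w := (Num.bound (10 / eps)).+2.
have weps : 10 <= w%:R * eps.
  rewrite -ler_pdivrMr//; apply: (@le_trans _ _ (Num.bound (10 / eps))%:R).
    by apply: ltW; apply: archi_boundP; rewrite divr_ge0// ltW.
  by rewrite ler_nat /w; lia.
(* The factor 4 is the fourth power lost in symmetrization, and the 1 absorbs the halving, as
   [M >= 2]. *)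
pose c := ((w * C0 + 1) * 4)%N.
pose s0 := structure_size c w; pose b := structure_exponent c w.
pose e0 := structure_threshold c w; pose N0 := (2 ^ (e0 * w))%N.
pose B : R := (s0 + b + N0 * N0)%:R.
exists B => n n0 d T P x y A hxy hrho.
(* Small [n] are covered by the summand [N0 * N0] of [B], which allows every entry to be a
   generator. *)
have [nN|nN] := leqP n N0.
  by apply: trivial_structure => //; rewrite ler_nat (leq_trans (leq_mul nN nN))// leq_addl.
have [e [ee0 nM nbig]] := nat_scale (isT : 0 < w)%N nN.
set M := (2 ^ e)%N in nM.
have e2 : (2 <= e)%N.
  by apply: leq_trans ee0; rewrite /e0 /structure_threshold; clear; lia.
have M0 : (0 < M)%N by rewrite expn_gt0.
have M2 : 2 <= M%:R :> R.
  by rewrite (ler_nat R 2) /M -{1}(expn1 2); apply: leq_pexp2l => //; exact: ltnW.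
have n1 : 1 <= n%:R :> R by rewrite ler1n.
have Mn : (M <= n)%N.
  apply: leq_trans (ltnW nbig); apply: leq_pexp2l => //.
  apply: (@leq_trans (e.-1 * 2)); last by rewrite leq_mul2l orbT.
  by move: e2; clear; lia.
have pow_le : (M ^ b)%:R <= n%:R `^ B.
  apply: (@le_trans _ _ (n%:R `^ b%:R)).
    rewrite powR_mulrn ?ler0n// -natrX ler_nat.
    exact: leq_expWl.
  by apply: ler_powR => //; rewrite ler_nat -addnA addnCA leq_addr.
have Meps : (M ^ 5)%:R <= n%:R `^ eps.
  apply: (@le_trans _ _ ((2 ^ (e.-1 * w))%:R `^ eps)); last first.
    by rewrite ge0_ler_powR ?nnegrE ?ler0n ?(ltW eps0)// ler_nat ltnW.
  have -> : (2 ^ (e.-1 * w))%:R `^ eps = 2 `^ ((e.-1 * w)%:R * eps) :> R.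
    by rewrite natrX -powR_mulrn// -powRrM.
  rewrite /M -expnM natrX -[leLHS]powR_mulrn//.
  apply: ler_powR; first by rewrite ler1n.
  rewrite (natrM _ e.-1) -mulrA; apply: (@le_trans _ _ (e.-1%:R * 10)).
    by rewrite -natrM ler_nat; move: e2; clear; lia.
  by rewrite ler_wpM2l.
have hA : M%:R ^- c <= bpr A (enum 'I_n ++ enum 'I_n) (enum 'I_n ++ enum 'I_n).
  have np : 0 < n%:R `^ (- C) by rewrite powR_gt0// ltr0n.
  apply: le_trans (rho_b_bpr hxy np hrho).
  rewrite /c exprM -exprVn ler_pXn2r ?nnegrE ?invr_ge0 ?exprn_ge0 ?divr_ge0 ?(ltW np)//.
  rewrite powRN -invfM lef_pV2 ?posrE ?exprn_gt0 ?ltr0n ?mulr_gt0 ?powR_gt0 ?ltr0n//.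
  rewrite addn1 exprSr ler_pM ?powR_ge0//.
  apply: le_trans (ler_powR n1 CC0) _.
  by rewrite powR_mulrn ?ler0n// exprM ler_pXn2r ?nnegrE ?exprn_ge0 ?ler0n// -natrX ler_nat.
have [I0 [J0 [I [J [k [l [kk [ll [g [[sz cI dI] [[kM lM kkM llM] [sg hI]]]]]]]]]]]] :=
  @bilinear_structure R c w n e A (ltnW ee0) n0 nM hA.
rewrite -/s0 -/b -/M in sz cI kM lM kkM llM sg hI.
have s0B k' : (k' <= s0)%N -> k'%:R <= B.
  by move=> h; rewrite ler_nat (leq_trans h)// -addnA leq_addr.
have intB (z : int) : (`|z| <= M ^ b)%N -> `|z%:~R| <= n%:R `^ B.
  move=> zb; apply: le_trans (pow_le).
  by rewrite -intr_norm -abszE -pmulrn ler_nat.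
have cardB (I' : {set 'I_n}) : (#|~: I'|%SET <= M ^ 5)%N -> n%:R - 1 * n%:R `^ eps <= #|I'|%:R.
  move=> h; rewrite mul1r lerBlDr; apply: (@le_trans _ _ (#|I'| + M ^ 5)%:R).
    by rewrite ler_nat -{1}(card_ord n) -(finset.cardsC I') leq_add2l.
  by rewrite natrD lerD2l.
have /andP[k0 kb] := kM; have /andP[l0 lb] := lM.
exists I0, J0, I, J, k%:Z, l%:Z, kk, ll, (size g), (fun h => g`_h).
exists (\matrix_(i, j) (A i j *+ (k * l) + (\sum_(i0 in I0) A i0 j *~ kk i i0) *+ l +
        (\sum_(j0 in J0) A i j0 *~ ll j0 j) *+ k)).
split; last split; split.
- by split; apply: s0B; case: sz.
- by split; apply: cardB; case: cI.
- exact: dI.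
- by rewrite !eqz_nat -!lt0n.
- by split; apply: intB.
- by move=> i i0 _ _; apply: intB.
- by move=> j0 j _ _; apply: intB.
- exact: s0B.
- move=> i j _ _; rewrite mxE.
  have kn : k%:R != 0 :> R by rewrite pnatr_eq0 -lt0n.
  have ln : l%:R != 0 :> R by rewrite pnatr_eq0 -lt0n.
  have -> : \sum_(i0 in I0) (kk i i0)%:~R * A i0 j = \sum_(i0 in I0) A i0 j *~ kk i i0.
    by apply: eq_bigr => i0 _; rewrite mulrzl.
  have -> : \sum_(j0 in J0) (ll j0 j)%:~R * A i j0 = \sum_(j0 in J0) A i j0 *~ ll j0 j.
    by apply: eq_bigr => j0 _; rewrite mulrzl.
  rewrite -!pmulrn -[A i j *+ _]mulr_natr -[_ *+ l]mulr_natr -[_ *+ k]mulr_natr natrM.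
  by field; rewrite kn ln.
- move=> i iI; have [E [cE hE]] := hI i iI.
  rewrite mul1r; apply: le_trans Meps; rewrite ler_nat; apply: leq_trans cE.
  apply: subset_leq_card; apply/fintype.subsetP => j /andP[/= jJ /negP nj].
  apply: contraT => jE; exfalso; apply: nj; apply: mem_set.
  rewrite mxE; apply: (rspan_rational (pow_le)).
  exact: hE.
Qed.
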